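(* Let $C(\xi)=\exp\left(-\frac12\|\xi\|^2\right)$ for $\xi\in H_{1,0}(S)$, where $\|\xi\|^2=\int_S|\xi(t)|^2\,dt$. Then the functional $C$ determines a probability measure $\mu$ on $(H_{-1}(S),\mathcal{B})$: there is a unique probability measure $\mu$ on $(H_{-1}(S),\mathcal{B})$ such that $$\int_{H_{-1}(S)}e^{i(x,\xi)}\,d\mu(x)=C(\xi)\qquad\text{for all }\xi\in H_{1,0}(S).$$ That is, $C$ is the characteristic functional of $\mu$.
   Context: $S=\mathbb{R}/\mathbb{Z}$ is the circle; $L^2(S)$ is the Hilbert space of square-integrable functions on $S$ with inner product $(f,g)=\int_S f(t)\overline{g(t)}\,dt$ and norm $\|\cdot\|$; $\psi_n(t)=e^{i2\pi nt}$, $n\in\mathbb{Z}$. The functions here are real-valued. The Sobolev space of order $1$ is $H_1(S)=\{f\in L^2(S):\sum_n n^2|(f,\psi_n)|^2<\infty\}$, and $H_{1,0}(S)=\{f\in H_1(S):(f,\psi_0)=0\}$, with norm $\|f\|_{H_{1,0}(S)}^2=\sum_n n^2|(f,\psi_n)|^2$. $H_{-1}(S)$ is the (continuous, real) dual space of $H_{1,0}(S)$; $(x,\xi)=(\xi,x)$ denotes the duality pairing of $x\in H_{-1}(S)$ and $\xi\in H_{1,0}(S)$. $\mathcal{B}$ is the Borel $\sigma$-algebra on $H_{-1}(S)$, i.e. the $\sigma$-algebra generated by the cylinder subsets of $H_{-1}(S)$. *)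

(* Defs.v *)
From HB Require Import structures.
From mathcomp Require Import all_boot all_order all_algebra.
From mathcomp Require Import complex ring.
From mathcomp Require Import all_classical all_reals all_analysis.
From mathcomp Require Import measurable_realfun.

Set Implicit Arguments.
Unset Strict Implicit.
Unset Printing Implicit Defensive.

Import Order.TTheory GRing.Theory Num.Theory.
Import numFieldNormedType.Exports.
Import ComplexField.Normc.

Local Open Scope classical_set_scope.
Local Open Scope ring_scope.
Local Open Scope complex_scope.
Local Open Scope quotient_scope.

Definition expi (R : realType) (x : R) : R[i] := cos x +i* sin x.

Section complex_integral.
Context d (T : measurableType d) (R : realType).
Variable mu : {measure set T -> \bar R}.

Definition Cintegral (f : T -> R[i]) : R[i] :=
  (\int[mu]_x complex.Re (f x)) +i* (\int[mu]_x complex.Im (f x)).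

Definition Cdot (f g : T -> R[i]) : R[i] :=
  Cintegral (fun t => f t * (g t)^*).

End complex_integral.

Section circle.
Variable R : realType.

Lemma lebesgue01_lty : (@lebesgue_measure R `[0%R, 1%R[%classic < +oo)%E.
Proof. by rewrite lebesgue_measure_itv/= lte_fin ltr01 oppr0 adde0 ltry. Qed.

(* [R/Z] is represented by its fundamental domain [[0, 1[]: functions on the
   circle are functions on the line, identified when they agree almost
   everywhere for the restriction of the Lebesgue measure to [[0, 1[]. *)
Definition circle_measure :
    {finite_measure set (measurableTypeR R) -> \bar R} :=
  mfrestr (f := lebesgue_measure) (measurable_itv `[0%R, 1%R[) lebesgue01_lty.

Definition psi (n : int) (t : R) : R[i] := expi (2 * pi * n%:~R * t).

Definition Lfun2 := LfunType circle_measure (lee1n 2).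

HB.instance Definition _ := GRing.Lmodule.on Lfun2.

Definition null_Lfun2 : {pred Lfun2} :=
  fun f => `[< f = cst 0 %[ae circle_measure] >].

Lemma null_Lfun2_submod : submod_closed null_Lfun2.
Proof.
split=> [|a f g /asboolP f0 /asboolP g0]; apply/asboolP.
  exact: ae_eq_refl.
apply: filterS2 f0 g0 => t ft gt _ /=.
by rewrite -[LHS]/(a * f t + g t) (ft I) (gt I) /= mulr0 addr0.
Qed.

HB.instance Definition _ := GRing.isSubmodClosed.Build R Lfun2 null_Lfun2
  null_Lfun2_submod.

(* The library's [LspaceType2] has no vector space structure, hence this
   quotient of the square-integrable functions by the null functions. *)
Definition L2S : Type := @Quotient.quot Lfun2 null_Lfun2.

HB.instance Definition _ := GRing.Zmodule.on L2S.
HB.instance Definition _ := EqQuotient.on L2S.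

Definition L2S_scale (a : R) (f : L2S) : L2S := \pi_L2S (a *: repr f).

Lemma pi_L2S_eqP (f g : Lfun2) :
  \pi_L2S f = \pi_L2S g <-> f = g %[ae circle_measure].
Proof.
split.
  move=> /eqP; rewrite -[_ == _]Quotient.idealrBE => /asboolP.
  by apply: filterS => t ft _; apply/eqP; rewrite -subr_eq0; apply/eqP; exact: ft I.
move=> fg; apply/eqP; rewrite -[_ == _]Quotient.idealrBE; apply/asboolP.
by apply: filterS fg => t ft _; apply/eqP; rewrite subr_eq0; apply/eqP; exact: ft I.
Qed.

Lemma repr_pi_L2S (f : Lfun2) :
  (repr (\pi_L2S f) : Lfun2) = f %[ae circle_measure].
Proof. by apply/pi_L2S_eqP; rewrite reprK. Qed.

Lemma pi_L2S_scale (a : R) (f : Lfun2) :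
  \pi_L2S (a *: f) = L2S_scale a (\pi_L2S f).
Proof.
apply/pi_L2S_eqP; apply: filterS (repr_pi_L2S f) => t ft _ /=.
by congr (a * _); exact/esym/(ft I).
Qed.

Lemma pi_L2S_add (f g : Lfun2) : \pi_L2S (f + g) = \pi_L2S f + \pi_L2S g.
Proof. by rewrite [LHS](Quotient.pi_add null_Lfun2). Qed.

Lemma L2S_scaleA (a b : R) (f : L2S) :
  L2S_scale a (L2S_scale b f) = L2S_scale (a * b) f.
Proof. by elim/quotW: f => f; rewrite -(pi_L2S_scale b f) -!pi_L2S_scale scalerA. Qed.

Lemma L2S_scale1 : left_id 1 L2S_scale.
Proof. by elim/quotW => f; rewrite -pi_L2S_scale scale1r. Qed.

Lemma L2S_scaleDr : right_distributive L2S_scale +%R.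
Proof.
move=> a; elim/quotW => f; elim/quotW => g.
by rewrite -pi_L2S_add -!pi_L2S_scale -pi_L2S_add scalerDr.
Qed.

Lemma L2S_scaleDl (f : L2S) : {morph L2S_scale^~ f : a b / a + b}.
Proof.
by elim/quotW: f => f a b; rewrite -!pi_L2S_scale -pi_L2S_add scalerDl.
Qed.

HB.instance Definition _ := GRing.Zmodule_isLmodule.Build R L2S
  L2S_scaleA L2S_scale1 L2S_scaleDr L2S_scaleDl.

Definition L2S_fun (f : L2S) : R -> R := (repr f : Lfun2).

Definition fourier (f : L2S) (n : int) : R[i] :=
  Cdot circle_measure (fun t => (L2S_fun f t)%:C) (psi n).

Definition sobolev1 (f : L2S) : \bar R :=
  \esum_(n in [set: int]) (n%:~R ^+ 2 * normc (fourier f n) ^+ 2)%:E.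

Definition H1_pred : {pred L2S} := fun f => `[< (sobolev1 f < +oo)%E >].

Definition H10_pred : {pred L2S} :=
  fun f => (f \in H1_pred) && `[< fourier f 0 = 0 >].

Lemma L2S_funD (a : R) (f g : L2S) :
  L2S_fun (a *: f + g) = (fun t => a * L2S_fun f t + L2S_fun g t)
    %[ae circle_measure].
Proof.
have -> : a *: f + g = \pi_L2S (a *: repr f + repr g).
  by rewrite pi_L2S_add pi_L2S_scale !reprK.
exact: repr_pi_L2S.
Qed.

Lemma integrable_L2S (f : L2S) : circle_measure.-integrable setT
  (EFin \o L2S_fun f).
Proof.
apply/Lfun1_integrable; apply: Lfun_subset12 (LfunP (repr f : Lfun2)).
by rewrite fin_num_measure.
Qed.

Lemma Rintegral_L2S_mul (h : R -> R) (a : R) (f g : L2S) :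
  measurable_fun setT h -> [bounded h x | x in setT] ->
  \int[circle_measure]_t (L2S_fun (a *: f + g) t * h t) =
  a * \int[circle_measure]_t (L2S_fun f t * h t) +
  \int[circle_measure]_t (L2S_fun g t * h t).
Proof.
move=> mh bh.
have ih u : circle_measure.-integrable setT
    (EFin \o (fun t => L2S_fun u t * h t)).
  exact: (integrableMl measurableT (integrable_L2S u) mh bh).
rewrite -RintegralZl// -RintegralD//; last first.
  exact: eq_integrable (integrableZl measurableT a (ih f)).
rewrite /Rintegral; congr fine; apply: ae_eq_integral => //.
- exact: measurable_int (ih _).
- exact: measurable_int (integrableD measurableT
    (integrableZl measurableT a (ih f)) (ih g)).
- have := L2S_funD a f g; apply: (@filterS _ _ (ae_filter_ringOfSetsType _)) => t /(_ I) /= -> _.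
  by rewrite mulrDl mulrA EFinD.
Qed.

Lemma fourierE (f : L2S) (n : int) : fourier f n =
  (\int[circle_measure]_t (L2S_fun f t * cos (2 * pi * n%:~R * t))) +i*
  (\int[circle_measure]_t (L2S_fun f t * - sin (2 * pi * n%:~R * t))).
Proof.
by congr (_ +i* _); apply: eq_Rintegral => t _ /=;
  rewrite mul0r ?subr0 ?addr0.
Qed.

Lemma fourierD (a : R) (f g : L2S) (n : int) :
  fourier (a *: f + g) n = a%:C * fourier f n + fourier g n.
Proof.
have bcos : [bounded cos (2 * pi * n%:~R * t) | t in [set: R]].
  by exists 1; split => // M M1 t _ /=; rewrite (le_trans (cos_max _))// ltW.
have bsin : [bounded - sin (2 * pi * n%:~R * t) | t in [set: R]].
  exists 1; split => // M M1 t _ /=.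
  by rewrite normrN (le_trans (sin_max _))// ltW.
have mlin : measurable_fun [set: R] (fun t : R => 2 * pi * n%:~R * t).
  exact: measurable_funM.
have mcos : measurable_fun [set: R] (fun t : R => cos (2 * pi * n%:~R * t)).
  apply: (measurableT_comp _ mlin).
  exact: continuous_measurable_fun (@continuous_cos R).
have msin : measurable_fun [set: R] (fun t : R => - sin (2 * pi * n%:~R * t)).
  apply: measurableT_comp => //; apply: (measurableT_comp _ mlin).
  exact: continuous_measurable_fun (@continuous_sin R).
rewrite !fourierE !Rintegral_L2S_mul//.
by apply/eqP; rewrite eq_complex /= !mul0r subr0 addr0 !eqxx.
Qed.

Lemma normc_sqr (z : R[i]) :
  normc z ^+ 2 = complex.Re z ^+ 2 + complex.Im z ^+ 2.
Proof. by case: z => x y /=; rewrite sqr_sqrtr// addr_ge0 ?sqr_ge0. Qed.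

Lemma le_esumZ (T : choiceType) (c : R) (u : T -> R) : 0 <= c ->
  (forall i, 0 <= u i) ->
  (\esum_(i in [set: T]) (c * u i)%:E <=
   c%:E * \esum_(i in [set: T]) (u i)%:E)%E.
Proof.
move=> c0 u0; apply: ub_ereal_sup => _ [A [finA _] <-].
under eq_fsbigr do rewrite EFinM.
rewrite -ge0_mule_fsumr => [|i]; last by rewrite lee_fin.
rewrite lee_pmul// ?lee_fin// ?fsume_ge0// => [i _|].
  by rewrite lee_fin.
by apply: ereal_sup_ubound; exists A.
Qed.

Lemma sobolev1D (a : R) (f g : L2S) : (sobolev1 f < +oo)%E ->
  (sobolev1 g < +oo)%E -> (sobolev1 (a *: f + g)%R < +oo)%E.
Proof.
move=> ff fg; pose w (h : L2S) (n : int) : R :=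
  n%:~R ^+ 2 * normc (fourier h n) ^+ 2.
have w0 h n : 0 <= w h n by rewrite mulr_ge0 ?sqr_ge0.
apply: (@le_lt_trans _ _ (\esum_(n in [set: int])
    ((2 * a ^+ 2 * w f n)%:E + (2 * w g n)%:E)%E)).
  apply: le_esum => n _; rewrite -EFinD lee_fin /w fourierD !normc_sqr.
  case: (fourier f n) (fourier g n) => x y [x' y'] /=.
  rewrite !mul0r subr0 addr0.
  rewrite -subr_ge0; set N : R := n%:~R.
  rewrite (_ : _ - _ = N ^+ 2 * ((a * x - x') ^+ 2 + (a * y - y') ^+ 2)).
    by rewrite mulr_ge0 ?addr_ge0 ?sqr_ge0.
  by ring.
rewrite esumD; last 2 first.
  by move=> n _; rewrite lee_fin mulr_ge0 ?w0// mulr_ge0 ?sqr_ge0.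
  by move=> n _; rewrite lee_fin mulr_ge0 ?w0.
apply: lte_add_pinfty.
  apply: le_lt_trans (le_esumZ _ (w0 f)) _; first by rewrite mulr_ge0 ?sqr_ge0.
  by rewrite lte_mul_pinfty// lee_fin mulr_ge0 ?sqr_ge0.
by apply: le_lt_trans (le_esumZ _ (w0 g)) _; rewrite // lte_mul_pinfty// lee_fin.
Qed.

Lemma H10_submod : submod_closed H10_pred.
Proof.
have f0 n : fourier 0 n = 0.
  have := fourierD 1 0 0 n; rewrite scale1r addr0 rmorph1 mul1r => /eqP.
  by rewrite -subr_eq subrr eq_sym => /eqP.
split=> [|a f g].
  apply/andP; split; apply/asboolP; last exact: f0.
  rewrite /sobolev1 esum1 => [|n _]; first exact: ltry.
  by rewrite f0 normc0 expr0n mulr0.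
move=> /andP[/asboolP Hf /asboolP f00] /andP[/asboolP Hg /asboolP g00].
apply/andP; split; apply/asboolP; first exact: sobolev1D.
by rewrite fourierD f00 g00 mulr0 addr0.
Qed.

HB.instance Definition _ := GRing.isSubmodClosed.Build R L2S H10_pred
  H10_submod.

Record H10 := MkH10 { H10_val :> L2S; H10_valP : H10_val \in H10_pred }.

HB.instance Definition _ := [isSub for H10_val].
HB.instance Definition _ := [Choice of H10 by <:].
HB.instance Definition _ := [SubChoice_isSubLmodule of H10 by <:].

Definition H10_norm (xi : H10) : R := Num.sqrt (fine (sobolev1 xi)).

(* The dual of [H10]; the second field is continuity for [H10_norm]. *)
Record Hm1 := MkHm1 {
  Hm1_fun :> {scalar H10};
  Hm1_continuous : forall xi0 : H10, forall e : R, 0 < e ->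
    exists2 delta : R, 0 < delta & forall xi : H10,
      H10_norm (xi - xi0) < delta -> `|Hm1_fun xi - Hm1_fun xi0| < e
}.

HB.instance Definition _ := gen_eqMixin Hm1.
HB.instance Definition _ := gen_choiceMixin Hm1.

Definition Hm1_zero : Hm1.
Proof.
exists (\0 : {scalar H10}) => xi0 e e0; exists 1 => // xi _.
by rewrite subrr normr0.
Defined.

HB.instance Definition _ := isPointed.Build Hm1 Hm1_zero.

Definition pairing (x : Hm1) (xi : H10) : R := x xi.

Definition cylinder : set (set Hm1) :=
  [set C | exists n (xi : 'I_n -> H10) (A : set (n.-tuple (measurableTypeR R))),
    measurable A /\ C = [set x | A [tuple pairing x (xi i) | i < n]]].

Definition Hm1_borel := g_sigma_algebraType cylinder.

Definition char_functional (mu : probability Hm1_borel R) (xi : H10) : R[i] :=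
  Cintegral mu (fun x : Hm1_borel => expi (pairing x xi)).

Definition L2_norm (f : L2S) : R :=
  Num.sqrt (\int[circle_measure]_t (`|L2S_fun f t| ^+ 2)).

Definition gaussC (xi : H10) : R := expR (- (2^-1 * L2_norm xi ^+ 2)).

End circle.

(* Main.v *)
Require Import Defs.
From HB Require Import structures.
From mathcomp Require Import all_boot all_order all_algebra.
From mathcomp Require Import complex ring lra zify.
From mathcomp Require Import all_classical all_reals all_analysis.
From mathcomp Require Import measurable_realfun.

Set Implicit Arguments.
Unset Strict Implicit.
Unset Printing Implicit Defensive.

Import Order.TTheory GRing.Theory Num.Theory.
Import numFieldNormedType.Exports.

Local Open Scope classical_set_scope.
Local Open Scope ring_scope.

(** The measure is the law of the random series x = sum_k g_k e_k, where the
    g_k are independent standard Gaussian variables and (e_k) is the real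
    trigonometric basis of the circle.

    Existence. If c_k are the coefficients of xi on (e_k), the pairing of x
    with xi is sum_k g_k c_k. With the weights w_k = (k+1)(k+2), the
    Cauchy-Schwarz inequality bounds it by the square root of
    (sum_k g_k^2 / w_k) (sum_k w_k c_k^2). The second factor is at most a
    constant times the squared Sobolev norm of xi ([weighted_coef_le]). The
    first one does not depend on xi and is almost surely finite, because g_k
    has second moment at most 1 and sum_k 1 / w_k = 1 ([summable_event_ae]). So
    almost every sample defines a continuous functional ([dual_element]). Its
    characteristic functional is the limit of exp (- sum_(k < n) c_k^2 / 2),
    that is exp (- |xi|^2 / 2) by Parseval's identity ([parseval]).

    The main tool is a determination principle, [trig_determination]: a functional
    on bounded measurable functions that is linear and continuous for bounded
    pointwise convergence, and that vanishes on the functions cos phi for phi in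
    an additive group of phases containing the constants, vanishes on the
    indicators of the sigma-algebra generated by these functions. Indeed the
    functions cos phi span an algebra, the indicator of cos phi >= s is a
    bounded limit of polynomials in cos phi, and the sets by whose indicators
    one can multiply without leaving the null functions form a sigma-algebra.
    The principle is used
    - for uniqueness: the pairings generate the sigma-algebra of the dual, so
      the characteristic functional determines the measure;
    - to show that the circle has a complete trigonometric system, which gives
      Parseval's identity;
    - to build the g_k on the unit interval: the binary digits of even and odd
      rank of a uniform point give two independent uniform points
      ([digits_independent]), since both sides of the identity to be proved
      satisfy the same contracting functional equation when tested against a
      cosine. Iterating the second point yields independent uniform variables,
      and the quantile function of the Gaussian law turns them into the g_k
      ([gaussian_seq_cf]). The characteristic function of that law comes from
      a linear differential equation ([normal_cf]).

    Complex exponentials are replaced throughout by cosines with an arbitrary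
    phase, cos (phi + c): letting c vary recovers real and imaginary parts, and
    the addition formulas keep all statements real. *)

(** * Functionals continuous for bounded convergence *)
Section bounded_convergence.
Context d (T : measurableType d) (R : realType).

Definition bddmeas (g : T -> R) :=
  measurable_fun setT g /\ exists C, forall x, `|g x| <= C.

(** Differences of integrals against two measures, or against one measure with
    an integrable density, are all of this kind; this common form lets one
    argument serve for measures and for densities. *)
Record bc_functional (L : (T -> R) -> R) : Prop := {
  bc_linear : forall a g h, bddmeas g -> bddmeas h ->
    L (fun x => a * g x + h x) = a * L g + L h ;
  bc_cvg : forall (g_ : nat -> T -> R) g C,
    (forall n, measurable_fun setT (g_ n)) ->
    (forall n x, `|g_ n x| <= C) ->
    (forall x, g_ n x @[n --> \oo] --> g x) ->
    L (g_ n) @[n --> \oo] --> L g }.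

Lemma bddmeas_cst c : bddmeas (fun=> c).
Proof. by split=> //; exists `|c|. Qed.

Lemma bddmeasD g h : bddmeas g -> bddmeas h -> bddmeas (fun x => g x + h x).
Proof.
move=> [mg [C gC]] [mh [D hD]]; split; first exact: measurable_funD.
by exists (C + D) => x; rewrite (le_trans (ler_normD _ _))// lerD.
Qed.

Lemma bddmeasM g h : bddmeas g -> bddmeas h -> bddmeas (fun x => g x * h x).
Proof.
move=> [mg [C gC]] [mh [D hD]]; split; first exact: measurable_funM.
by exists (C * D) => x; rewrite normrM ler_pM.
Qed.

Lemma bddmeas_indic A : measurable A -> bddmeas (\1_A).
Proof.
move=> mA; split; first exact: measurable_indic.
by exists 1 => x; rewrite indicE; case: (x \in A); rewrite ?normr1 ?normr0.
Qed.

Lemma bddmeas_cos (phi : T -> R) :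
  measurable_fun setT phi -> bddmeas (fun x => cos (phi x)).
Proof.
move=> mphi; split; last by exists 1 => x; exact: cos_max.
apply: (measurableT_comp _ mphi).
exact: continuous_measurable_fun (@continuous_cos R).
Qed.

Lemma bddmeas_integrable (mu : {finite_measure set T -> \bar R}) g :
  bddmeas g -> mu.-integrable setT (EFin \o g).
Proof.
move=> [mg [C gC]]; apply: measurable_bounded_integrable => //.
  by rewrite -ge0_fin_numE// fin_num_measure.
by exists C; split; rewrite ?num_real// => M CM x _; exact: le_trans (gC x) (ltW CM).
Qed.

Lemma bddmeas_integrableM (mu : {measure set T -> \bar R}) g (f : T -> R) :
  bddmeas g -> mu.-integrable setT (EFin \o f) ->
  mu.-integrable setT (EFin \o (fun x => g x * f x)).
Proof.
move=> [mg [C gC]] intf.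
apply: eq_integrable (integrableMr measurableT mg _ intf) => //.
exists C; split; rewrite ?num_real// => M CM x _.
exact: le_trans (gC x) (ltW CM).
Qed.

Lemma integral_bc_functional (mu : {measure set T -> \bar R}) (f : T -> R) :
  mu.-integrable setT (EFin \o f) ->
  bc_functional (fun g => \int[mu]_x (g x * f x)).
Proof.
move=> intf.
have intgf g : bddmeas g -> mu.-integrable setT (EFin \o (fun x => g x * f x)).
  by move=> bg; exact: (bddmeas_integrableM bg intf).
split=> [a g h bg bh|g_ g C mg_ g_C g_g].
  rewrite -RintegralZl ?intgf//.
  rewrite -RintegralD ?intgf//; last first.
    by apply: eq_integrable (integrableZl measurableT a (intgf g bg)).
  by apply: eq_Rintegral => x _; rewrite mulrDl mulrA.
have mg : measurable_fun setT g by exact: measurable_fun_cvg mg_ _.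
have mf : measurable_fun setT f by exact/measurable_EFinP/(measurable_int mu).
have intCf : mu.-integrable setT (fun x => `|(C * f x)%:E|)%E.
  apply: integrable_abse.
  exact: eq_integrable (integrableZl measurableT C intf).
have [] := @dominated_convergence _ _ _ mu setT measurableT
  (fun n x => (g_ n x * f x)%:E) (fun x => (g x * f x)%:E)
  (fun x => `|(C * f x)%:E|)%E _ _ _ intCf _.
- by move=> n; apply/measurable_EFinP/measurable_funM.
- by apply/measurable_EFinP/measurable_funM.
- apply/aeW => x _; apply: cvg_EFin; first exact: nearW.
  by apply: cvgM => //; exact: cvg_cst.
- apply/aeW => x n _; rewrite lee_fin !normrM ler_wpM2r//.
  exact: le_trans (g_C n x) (ler_norm _).
- move=> intgf' _ cv; apply/fine_cvg; rewrite fineK//.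
  exact: integrable_fin_num intgf'.
Qed.

Lemma bc_functional0 (L : (T -> R) -> R) : bc_functional L -> L (fun=> 0) = 0.
Proof.
move=> bcL; have := bc_linear bcL 1 (bddmeas_cst 0) (bddmeas_cst 0).
under eq_fun do rewrite mulr0 addr0.
by rewrite mul1r => /eqP; rewrite -subr_eq subrr eq_sym => /eqP.
Qed.

Lemma bc_functionalB L M : bc_functional L -> bc_functional M ->
  bc_functional (fun g => L g - M g).
Proof.
move=> [Ll Lc] [Ml Mc]; split=> [a g h bg bh|g_ g C mg gC gg].
  by rewrite Ll// Ml// mulrBr opprD addrACA.
by apply: cvgB; [exact: Lc mg gC gg|exact: Mc mg gC gg].
Qed.

End bounded_convergence.

Section bc_functional_theory.
Context d (T : measurableType d) (R : realType).
Implicit Type L : (T -> R) -> R.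
Import HBNNSimple.

Lemma bc_functionalZD L M a : bc_functional L -> bc_functional M ->
  bc_functional (fun g => a * L g + M g).
Proof.
move=> [Ll Lc] [Ml Mc]; split=> [b g h bg bh|g_ g C mg gC gg].
  by rewrite Ll// Ml//; ring.
apply: cvgD; last exact: Mc mg gC gg.
by apply: cvgM; [exact: cvg_cst|exact: Lc mg gC gg].
Qed.

Lemma bddmeas_comp d' (T' : measurableType d') (phi : T -> T') (g : T' -> R) :
  measurable_fun setT phi -> bddmeas g -> bddmeas (fun x => g (phi x)).
Proof.
move=> mphi [mg [C gC]]; split; first exact: measurableT_comp mg mphi.
by exists C.
Qed.

(** Bounded measurable functions are bounded limits of simple functions, once
    made nonnegative by adding a constant. *)
Lemma bc_functional_eq0 L : bc_functional L ->
  (forall A, measurable A -> L (\1_A) = 0) ->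
  forall g, bddmeas g -> L g = 0.
Proof.
move=> bcL L0.
have L0cst c : L (fun=> c) = 0.
  have := bc_linear bcL c (bddmeas_indic R (@measurableT _ T)) (bddmeas_cst T (0:R)).
  rewrite L0// bc_functional0// mulr0 addr0 => <-; congr L.
  by apply/funext => x; rewrite indicT addr0 mulr1.
have Lnn (g : T -> R) C : measurable_fun setT g -> (forall x, 0 <= g x) ->
    (forall x, g x <= C) -> L g = 0.
  move=> mg g0 gC.
  have mEg : measurable_fun setT (EFin \o g) by exact/measurable_EFinP.
  pose s := nnsfun_approx measurableT mEg.
  have cvs x : s n x @[n --> \oo] --> g x.
    have := cvg_nnsfun_approx measurableT mEg (fun x _ => g0 x : (0 <= (g x)%:E)%E) (I : setT x).
    by move=> /fine_cvg.
  have ms n : measurable_fun setT (s n) by exact: measurable_funP.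
  have sC n x : `|s n x| <= C.
    rewrite ger0_norm//; apply: le_trans (gC x).
    rewrite -(cvg_lim _ (cvs x))//.
    apply: (@nondecreasing_cvgn_le _ (fun n => s n x)); last exact: cvgP (cvs x).
    by move=> m k mk; have /lefP := nd_nnsfun_approx measurableT mEg mk.
  have : L (s n) @[n --> \oo] --> L g := bc_cvg bcL ms sC cvs.
  have -> : (fun n => L (s n)) = fun=> 0.
    apply/funext => n.
    pose sq := finmap.enum_fset (fset_set (range (s n))).
    pose h (i : nat) x : R := sq`_i * \1_(s n @^-1` [set sq`_i]) x.
    have -> : L (s n) = L (fun x => \sum_(i < size sq) h i x).
      by congr L; apply/funext => x; rewrite fimfunEord.
    have bi (i : nat) : bddmeas (\1_(s n @^-1` [set sq`_i]) : T -> R).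
      by apply: bddmeas_indic; exact: measurable_sfunP.
    suff /(_ (size sq))[] : forall N, bddmeas (fun x => \sum_(i < N) h i x) /\
        L (fun x => \sum_(i < N) h i x) = 0 by [].
    elim => [|N [IH1 IH2]].
      under eq_fun do rewrite big_ord0.
      by split; [exact: bddmeas_cst|exact: bc_functional0].
    have -> : (fun x => \sum_(i < N.+1) h i x) =
        (fun x => sq`_N * \1_(s n @^-1` [set sq`_N]) x + \sum_(i < N) h i x).
      by apply/funext => x; rewrite big_ord_recr/= addrC.
    rewrite (bc_linear bcL)// IH2 L0 ?mulr0 ?addr0; last exact: measurable_sfunP.
    split=> //; apply: bddmeasD => //.
    by apply: bddmeasM => //; exact: bddmeas_cst.
  by move=> /cvg_lim <-//; rewrite lim_cst.
move=> g [mg [C gC]].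
have gCb x : - C <= g x <= C by rewrite -ler_norml.
have := Lnn (fun x => 1 * g x + C) (C + C).
rewrite (bc_linear bcL) ?L0cst ?mul1r ?addr0; last 2 first.
- by split=> //; exists C.
- exact: bddmeas_cst.
apply=> [|x|x].
- by apply: measurable_funD => //; exact: measurable_funM.
- by have := gCb x; lra.
- by have := gCb x; lra.
Qed.

End bc_functional_theory.

Section bc_functional_constructions.
Context d (T : measurableType d) (R : realType).

Lemma Rintegral_bc_functional (mu : {finite_measure set T -> \bar R}) :
  bc_functional (fun g => \int[mu]_x g x).
Proof.
have int1 : mu.-integrable setT (EFin \o (fun=> 1 : R)).
  exact/bddmeas_integrable/bddmeas_cst.
have := integral_bc_functional int1; congr bc_functional.
by apply/funext => g; apply: eq_Rintegral => x _; rewrite mulr1.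
Qed.

Lemma bc_functional_comp d' (T' : measurableType d') (L' : (T' -> R) -> R)
    (phi : T' -> T) : bc_functional L' -> measurable_fun setT phi ->
  bc_functional (fun g => L' (fun x => g (phi x))).
Proof.
move=> [Ll Lc] mphi; split=> [a g h bg bh|g_ g C mg gC gg].
  by rewrite -Ll//; exact: bddmeas_comp.
apply: (Lc _ _ C) => // n; exact: measurableT_comp (mg n) mphi.
Qed.

Lemma bc_functional_sum (L : (T -> R) -> R) (a : nat -> R)
    (e : nat -> T -> R) : bc_functional L -> (forall k, bddmeas (e k)) ->
  forall n, bddmeas (fun x => \sum_(k < n) a k * e k x) /\
    L (fun x => \sum_(k < n) a k * e k x) = \sum_(k < n) a k * L (e k).
Proof.
move=> bcL be; elim=> [|n [IH1 IH2]].
  under eq_fun do rewrite big_ord0.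
  by rewrite big_ord0; split; [exact: bddmeas_cst|exact: bc_functional0].
have -> : (fun x => \sum_(k < n.+1) a k * e k x) =
    (fun x => a n * e n x + \sum_(k < n) a k * e k x).
  by apply/funext => x; rewrite big_ord_recr/= addrC.
rewrite (bc_linear bcL)// IH2 big_ord_recr/= addrC; split=> //.
by apply: bddmeasD => //; apply: bddmeasM => //; exact: bddmeas_cst.
Qed.

End bc_functional_constructions.

(** * Polynomials approximating a step function *)
Section step.
Context (R : realType).

Lemma bernoulli_ineq (x : R) n : -1 <= x -> 1 + n%:R * x <= (1 + x) ^+ n.
Proof.
move=> x1; elim: n => [|n IH]; first by rewrite mul0r addr0 expr0.
rewrite exprS; have x0 : 0 <= 1 + x by lra.
apply: le_trans (ler_wpM2l x0 IH).
have n0 : 0 <= n%:R * (x * x) by rewrite mulr_ge0// -expr2 sqr_ge0.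
by rewrite -natr1; nra.
Qed.

(** For h in [0, 1], the power (1 - h^n)^m with m = n 2^n stays close to
    1 - n (2h)^n, hence to 1, when h < 1/2; when h >= 1/2 it is at most
    1 / (1 + m h^n) <= 1 / (1 + n). The factor n in m is what makes the limit at
    h = 1/2 equal to 1. *)
Definition step_poly n : {poly R} :=
  1 - (1 - 'X ^+ n) ^+ (n * 2 ^ n).

Lemma step_polyE n h : (step_poly n).[h] = 1 - (1 - h ^+ n) ^+ (n * 2 ^ n).
Proof. by rewrite /step_poly !(hornerE, horner_exp). Qed.

Lemma step_poly01 n h : 0 <= h <= 1 -> 0 <= (step_poly n).[h] <= 1.
Proof.
move=> /andP[h0 h1]; rewrite step_polyE.
have a0 : 0 <= h ^+ n by exact: exprn_ge0.
have a1 : h ^+ n <= 1 by exact: exprn_ile1.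
have : 0 <= (1 - h ^+ n) ^+ (n * 2 ^ n) by apply: exprn_ge0; lra.
have : (1 - h ^+ n) ^+ (n * 2 ^ n) <= 1 by apply: exprn_ile1; lra.
lra.
Qed.

Lemma step_poly_cvg h : 0 <= h <= 1 ->
  (step_poly n).[h] @[n --> \oo] --> ((2^-1 <= h)%R%:R : R).
Proof.
move=> /andP[h0 h1]; case: leP => h2.
- rewrite [X in _ --> X](_ : _ = 1 - 0); last by rewrite subr0.
  under eq_fun do rewrite step_polyE.
  apply: cvgB; first exact: cvg_cst.
  have u0 : (fun n => n.+1%:R^-1 : R) @ \oo --> (0 : R) by exact: cvg_harmonic.
  apply: (squeeze_cvgr _ (@cvg_cst _ _ _ _ _) u0).
  apply/nearW => n.
  have a0 : 0 <= h ^+ n by exact: exprn_ge0.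
  have a1 : h ^+ n <= 1 by exact: exprn_ile1.
  apply/andP; split; first by apply: exprn_ge0; lra.
  rewrite -[leRHS]div1r ler_pdivlMr ?ltr0n//.
  have H : n.+1%:R <= (1 + h ^+ n) ^+ (n * 2 ^ n).
    apply: le_trans (bernoulli_ineq _ _); last by lra.
    rewrite natrM natrX -mulrA -exprMn.
    have : 1 <= (2 * h) ^+ n by apply: exprn_ege1; lra.
    have : (0:R) <= n%:R by [].
    by rewrite -natr1; nra.
  apply: (@le_trans _ _ ((1 - h ^+ n) ^+ (n * 2 ^ n) * (1 + h ^+ n) ^+ (n * 2 ^ n))).
    by apply: ler_wpM2l => //; apply: exprn_ge0; lra.
  rewrite -exprMn; apply: exprn_ile1; nra.
- rewrite (_ : false%:R = 0 :> R)//.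
  (* n (2h)^n -> 0: as 2h <= s^2 with s = 1/2 + h < 1, it is at most
     (n s^n) s^n, and n s^n is bounded by the Bernoulli inequality *)
  pose s : R := 2^-1 + h; pose x := s^-1 - 1.
  have s0 : 0 < s by rewrite /s; lra.
  have s1 : s < 1 by rewrite /s; lra.
  have x0 : 0 < x by rewrite /x subr_gt0 invf_gt1.
  have c0 : (fun n => x^-1 * s ^+ n) @ \oo --> (0 : R).
    by apply: cvg_geometric; rewrite ger0_norm ?ltW.
  apply: (squeeze_cvgr _ (@cvg_cst _ _ _ _ _) c0).
  apply/nearW => n.
  have h01 : 0 <= h <= 1 by apply/andP; split; lra.
  have /andP[-> _] := step_poly01 n h01; rewrite /= step_polyE.
  have a0 : 0 <= h ^+ n by exact: exprn_ge0.
  have a1 : h ^+ n <= 1 by exact: exprn_ile1.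
  have : 1 + (n * 2 ^ n)%:R * - h ^+ n <= (1 - h ^+ n) ^+ (n * 2 ^ n).
    by apply: bernoulli_ineq; lra.
  have : n%:R * (2 * h) ^+ n <= x^-1 * s ^+ n.
    have : (2 * h) ^+ n <= (s * s) ^+ n by apply: lerXn2r; rewrite ?nnegrE /s; nra.
    rewrite [(s * s) ^+ n]exprMn => H.
    apply: (le_trans (ler_wpM2l _ H)) => //.
    rewrite mulrA ler_wpM2r ?exprn_ge0 ?(ltW s0)//.
    rewrite -[leRHS]div1r ler_pdivlMr// mulrAC.
    have := bernoulli_ineq n (ltW (lt_trans (ltrN10 R) x0)).
    rewrite (_ : 1 + x = s^-1); last by rewrite /x addrC subrK.
    rewrite exprVn -[leRHS]div1r ler_pdivlMr ?exprn_gt0//.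
    have : 0 < s ^+ n by exact: exprn_gt0.
    nra.
  by rewrite natrM natrX exprMn; nra.
Qed.

End step.

(** * Determination by trigonometric integrals *)
Section trigonometric_determination.
Context d (T : measurableType d) (R : realType).
Variables (L : (T -> R) -> R) (Phi : set (T -> R)).
Hypothesis bcL : bc_functional L.
Hypothesis mPhi : forall phi, Phi phi -> measurable_fun setT phi.
Hypothesis PhiB : forall phi psi, Phi phi -> Phi psi ->
  Phi (fun x => phi x - psi x).
Hypothesis Phi_cst : forall c, Phi (fun=> c).
Hypothesis Lcos : forall phi, Phi phi -> L (fun x => cos (phi x)) = 0.

Definition trig_sets : set (set T) :=
  [set A | exists phi s, Phi phi /\ A = [set x | s <= cos (phi x)]].

Let PhiD phi psi : Phi phi -> Phi psi -> Phi (fun x => phi x + psi x).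
Proof.
move=> Pphi Ppsi; have := PhiB Pphi (PhiB (Phi_cst 0) Ppsi).
by congr Phi; apply/funext => x; rewrite sub0r opprK.
Qed.

(** The null functions: they are stable under linear combinations, products by
    cosines of phases (addition formulas) and bounded limits. *)
Let trig_null g := bddmeas g /\
  forall phi, Phi phi -> L (fun x => g x * cos (phi x)) = 0.

Let trig_null1 : trig_null (fun=> 1).
Proof.
split=> [|phi Pphi]; first exact: bddmeas_cst.
by under eq_fun do rewrite mul1r; exact: Lcos.
Qed.

Let bddcos phi : Phi phi -> bddmeas (fun x => cos (phi x)).
Proof. by move=> Pphi; apply/bddmeas_cos/mPhi. Qed.

Let trig_nullD a g h : trig_null g -> trig_null h ->
  trig_null (fun x => a * g x + h x).
Proof.
move=> [bg Lg] [bh Lh]; split=> [|phi Pphi].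
  by apply: bddmeasD => //; apply: bddmeasM => //; exact: bddmeas_cst.
transitivity (a * L (fun x => g x * cos (phi x)) + L (fun x => h x * cos (phi x))).
  rewrite -(bc_linear bcL); last 2 first.
  - exact/bddmeasM/bddcos.
  - exact/bddmeasM/bddcos.
  by congr L; apply/funext => x; rewrite mulrDl mulrA.
by rewrite Lg// Lh// mulr0 addr0.
Qed.

Let trig_null_cos g phi : Phi phi -> trig_null g ->
  trig_null (fun x => g x * cos (phi x)).
Proof.
move=> Pphi [bg Lg]; split=> [|psi Ppsi]; first exact/bddmeasM/bddcos.
transitivity (2^-1 * L (fun x => g x * cos (phi x - psi x)) +
              2^-1 * L (fun x => g x * cos (phi x + psi x))).
  have bB := bddmeasM bg (bddcos (PhiB Pphi Ppsi)).
  have bD := bddmeasM bg (bddcos (PhiD Pphi Ppsi)).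
  have L0 := bc_functional0 bcL.
  have -> : 2^-1 * L (fun x => g x * cos (phi x + psi x)) =
      L (fun x => 2^-1 * (g x * cos (phi x + psi x)) + 0).
    by rewrite (bc_linear bcL)// ?L0 ?addr0//; exact: bddmeas_cst.
  rewrite -(bc_linear bcL)//; last first.
    apply: bddmeasD; last exact: bddmeas_cst.
    by apply: bddmeasM => //; exact: bddmeas_cst.
  by congr L; apply/funext => x; rewrite cosB cosD; field.
by rewrite Lg ?(Lg _ (PhiD _ _))// ?mulr0 ?addr0//; exact: PhiB.
Qed.

Let trig_null_poly g phi p a b : Phi phi -> trig_null g ->
  trig_null (fun x => g x * p.[a * cos (phi x) + b]).
Proof.
move=> Pphi; elim/poly_ind: p g => [|p c IH] g ng.
  under eq_fun do rewrite horner0 mulr0.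
  have := trig_nullD (-1) trig_null1 trig_null1.
  by under eq_fun do rewrite mulN1r addNr.
have -> : (fun x => g x * (p * 'X + c%:P).[a * cos (phi x) + b]) =
    (fun x => a * ((g x * cos (phi x)) * p.[a * cos (phi x) + b]) +
       (b * (g x * p.[a * cos (phi x) + b]) + (c * g x + 0 * g x))).
  by apply/funext => x; rewrite hornerD hornerMX hornerC; ring.
apply: trig_nullD; first exact/IH/trig_null_cos.
apply: trig_nullD; first exact: IH.
apply: trig_nullD => //.
have := trig_nullD (-1) ng ng.
by congr trig_null; apply/funext => x; ring.
Qed.

Let trig_null_cvg (g_ : nat -> T -> R) g C :
  (forall n, trig_null (g_ n)) -> (forall n x, `|g_ n x| <= C) ->
  (forall x, g_ n x @[n --> \oo] --> g x) -> trig_null g.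
Proof.
move=> ng gC gg.
have mg n : measurable_fun setT (g_ n) by case: (ng n) => -[].
split=> [|phi Pphi].
  split; first exact: measurable_fun_cvg mg _.
  exists C => x; rewrite -(cvg_lim _ (cvg_norm (gg x)))//.
  by apply: limr_le; [exact: (cvgP _ (cvg_norm (gg x)))|exact: nearW].
have : L (fun x => g_ n x * cos (phi x)) @[n --> \oo] --> L (fun x => g x * cos (phi x)).
  apply: (bc_cvg bcL (C := C)).
  - by move=> n; apply: measurable_funM => //; case: (bddcos Pphi).
  - move=> n x; rewrite normrM -[leRHS]mulr1 ler_pM//; exact: cos_max.
  - by move=> x; apply: cvgM => //; exact: cvg_cst.
under eq_fun do rewrite (proj2 (ng _))//.
by move=> /cvg_lim <-//; rewrite lim_cst.
Qed.

(** Unlike the condition that the indicator of A is null, this condition is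
    visibly stable under intersections, so that these sets form a sigma-algebra
    and not only a lambda-system. *)
Let trig_stable (A : set T) := measurable A /\
  forall g, trig_null g -> trig_null (fun x => g x * \1_A x).

Let trig_stable_sigma : sigma_algebra setT trig_stable.
Proof.
have stableC A : trig_stable A -> trig_stable (~` A).
  move=> [mA sA]; split=> [|g ng]; first exact: measurableC.
  have := trig_nullD (-1) (sA g ng) ng.
  congr trig_null; apply/funext => x; rewrite !indicE in_setC.
  by case: (x \in A) => /=; rewrite ?mulr1n ?mulr0n; ring.
have stableI A B : trig_stable A -> trig_stable B -> trig_stable (A `&` B).
  move=> [mA sA] [mB sB]; split=> [|g ng]; first exact: measurableI.
  have := sB _ (sA g ng).
  congr trig_null; apply/funext => x; rewrite !indicE in_setI.
  by case: (x \in A); case: (x \in B); rewrite /= ?mulr1n ?mulr0n; ring.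
have stable0 : trig_stable set0.
  split=> // g ng; have := trig_nullD (-1) ng ng.
  congr trig_null; apply/funext => x; rewrite indicE in_set0/= ?mulr0n; ring.
have stableU A B : trig_stable A -> trig_stable B -> trig_stable (A `|` B).
  by move=> sA sB; rewrite -[_ `|` _]setCK setCU;
    apply: (stableC); apply: (stableI); apply: stableC.
split=> [//|A sA|F sF].
  by rewrite setTD; exact: stableC.
pose G n := \big[setU/set0]_(i < n) F i.
have sG n : trig_stable (G n).
  by elim: n => [|n IH]; rewrite /G ?big_ord0// big_ord_recr /=; exact: stableU.
split=> [|g ng].
  by apply: bigcup_measurable => k _; case: (sF k).
have [_ [C gC]] := proj1 ng.
apply: (@trig_null_cvg (fun n x => g x * \1_(G n) x) _ C).
- by move=> n; exact: (proj2 (sG n)).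
- move=> n x; rewrite indicE; case: (x \in _); rewrite ?mulr1// mulr0 normr0.
  exact: le_trans (gC x).
- move=> x; apply: cvgM; first exact: cvg_cst.
  have [[k _ Fkx]|nF] := pselect ((\bigcup_k F k) x).
  + apply: (@cvg_near_cst); near=> n.
    rewrite !indicE !mem_set//; first by exists k.
    rewrite /G -bigcup_mkord; exists k => //=.
    by near: n; exact: nbhs_infty_gt.
  + have -> : (fun n => \1_(G n) x) = (fun=> (\1_(\bigcup_k F k) x : R)).
      apply/funext => n; rewrite !indicE !memNset// /G.
      by rewrite -bigcup_mkord => -[k _ Fkx]; apply: nF; exists k.
    exact: cvg_cst.
Unshelve. all: end_near. Qed.

Let trig_stable_ge phi s : Phi phi -> trig_stable [set x | s <= cos (phi x)].
Proof.
move=> Pphi; have [mcos _] := bddcos Pphi.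
have mA : measurable [set x | s <= cos (phi x)].
  have := mcos measurableT _ (measurable_itv `[s, +oo[).
  by rewrite setTI; congr measurable; apply/seteqP; split=> x /=; rewrite in_itv/= andbT.
split=> // g ng.
have [s1|s1] := leP s (-1).
  have -> : (fun x => g x * \1_[set x | s <= cos (phi x)] x) = g => //.
  apply/funext => x; rewrite indicE mem_set ?mulr1//=.
  exact: le_trans s1 (cos_geN1 _).
have [s2|s2] := ltP 1 s.
  have -> : (fun x => g x * \1_[set x | s <= cos (phi x)] x) = fun x => -1 * g x + g x.
    apply/funext => x; rewrite indicE memNset ?mulr0//=; first by ring.
    by move/(lt_le_trans s2); rewrite ltNge cos_le1.
  exact: trig_nullD.
have [_ [C gC]] := proj1 ng.
(* for s in ]-1, 1], (cos phi - s + 2) / 4 lies in [0, 1], and it is at least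
   1/2 exactly when cos phi >= s *)
have h01 x : 0 <= 4^-1 * cos (phi x) + (2 - s) / 4 <= 1.
  by have := cos_geN1 (phi x); have := cos_le1 (phi x); lra.
apply: (@trig_null_cvg (fun n x => g x * (step_poly R n).[
  4^-1 * cos (phi x) + (2 - s) / 4]) _ C).
- by move=> n; exact: trig_null_poly.
- move=> n x; have /andP[p0 p1] := step_poly01 n (h01 x).
  by rewrite normrM -[leRHS]mulr1 ler_pM// ger0_norm.
- move=> x; apply: cvgM; first exact: cvg_cst.
  rewrite indicE (_ : (x \in _) = (2^-1 <= 4^-1 * cos (phi x) + (2 - s) / 4)).
    exact: step_poly_cvg.
  apply/idP/idP => [/set_mem/=|H]; first by lra.
  by apply/mem_set => /=; lra.
Qed.

Theorem trig_determination A : <<s trig_sets >> A -> measurable A /\ L (\1_A) = 0.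
Proof.
move=> sA; have [mA stA] : trig_stable A.
  apply: sA; split; first exact: trig_stable_sigma.
  by move=> _ [phi [s [Pphi ->]]]; exact: trig_stable_ge.
split=> //; have [_ /(_ _ (Phi_cst 0))] := stA _ trig_null1.
by congr (L _ = _); apply/funext => x; rewrite cos0 mulr1 mul1r.
Qed.

End trigonometric_determination.

Section cos_measure_unique.
Context d (T : measurableType d) (R : realType).
Variable Phi : set (T -> R).
Hypothesis mPhi : forall phi, Phi phi -> measurable_fun setT phi.
Hypothesis PhiB : forall phi psi, Phi phi -> Phi psi ->
  Phi (fun x => phi x - psi x).
Hypothesis Phi_cst : forall c, Phi (fun=> c).

Lemma measurable_trig_cos phi : Phi phi ->
  measurable_fun (setT : set (g_sigma_algebraType (trig_sets Phi)))
    (fun x => cos (phi x)).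
Proof.
move=> Pphi; apply: (measurability _ (RGenCInfty.measurableE R)) => //.
move=> _ [_ [s ->] <-]; apply: sub_sigma_algebra; exists phi, s; split=> //.
by rewrite setTI; apply/seteqP; split=> x /=; rewrite in_itv/= andbT.
Qed.

Lemma cvg_sin_scale (y : R) : n.+1%:R * sin (y / n.+1%:R) @[n --> \oo] --> y.
Proof.
have [->|y0] := eqVneq y 0.
  under eq_fun do rewrite mul0r sin0 mulr0.
  exact: cvg_cst.
have [dsin dsinE] := is_derive_sin (0 : R).
have /cvgr_dnbhsP/(_ (fun n => y / n.+1%:R)) := dsin.
move=> /(_ _)/wrap[|H].
  split=> [n|]; first by rewrite mulf_neq0// invr_eq0.
  rewrite -[X in _ --> X](mulr0 y).
  by apply: cvgM; [exact: cvg_cst|exact: cvg_harmonic].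
have -> : (fun n => n.+1%:R * sin (y / n.+1%:R)) =
    (fun n => y * ((y / n.+1%:R)^-1 *: (sin (y / n.+1%:R *: 1 + 0) - sin 0))).
  apply/funext => n; rewrite addr0 /GRing.scale /= mulr1 sin0 subr0.
  by rewrite mulrA invfM invrK mulrA divff// mul1r.
rewrite -[X in _ --> X]mulr1; apply: cvgM; first exact: cvg_cst.
by move: H; rewrite [X in _ --> X -> _](_ : _ = 'D_1 sin 0)// dsinE cos0.
Qed.

(** A phase is recovered from its small multiples, as the limit of
    n sin (phi / n); the sine is the cosine of another phase. *)
Lemma measurable_trig_phase phi :
  (forall n, Phi (fun x => phi x / n.+1%:R)) ->
  measurable_fun (setT : set (g_sigma_algebraType (trig_sets Phi))) phi.
Proof.
move=> Pphi; refine (@measurable_fun_cvg _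
  (g_sigma_algebraType (trig_sets Phi)) R setT
  (fun n x => n.+1%:R * sin (phi x / n.+1%:R)) phi _ _).
  move=> n; apply: measurable_funM => //.
  under eq_fun do rewrite -cosBpihalf.
  exact: (measurable_trig_cos (PhiB (Pphi n) (Phi_cst (pi / 2)))).
by move=> x _; exact: cvg_sin_scale.
Qed.

Lemma cos_measure_unique (mu nu : {finite_measure set T -> \bar R}) :
  (forall phi, Phi phi -> \int[mu]_x cos (phi x) = \int[nu]_x cos (phi x)) ->
  forall A, measurable (A : set (g_sigma_algebraType (trig_sets Phi))) ->
    mu A = nu A.
Proof.
move=> munu A sA.
have int1 (m : {finite_measure set T -> \bar R}) :
    m.-integrable setT (EFin \o (fun=> 1 : R)).
  exact/bddmeas_integrable/bddmeas_cst.
have bcL := bc_functionalB (integral_bc_functional (int1 mu))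
  (integral_bc_functional (int1 nu)).
have [|mA] := trig_determination bcL mPhi PhiB Phi_cst _ sA.
  move=> phi Pphi.
  under eq_Rintegral do rewrite mulr1.
  under [X in _ - X]eq_Rintegral do rewrite mulr1.
  by rewrite munu// subrr.
under eq_Rintegral do rewrite mulr1.
under [X in _ - X]eq_Rintegral do rewrite mulr1.
rewrite /Rintegral !integral_indic// !setIT => /eqP; rewrite subr_eq0 => /eqP E.
by rewrite -(@fineK _ (mu A)) ?fin_num_measure// E fineK ?fin_num_measure.
Qed.

End cos_measure_unique.

(** * The uniform distribution and its binary digits *)
Section circle_prob.
Context (R : realType).
Local Notation mu := (@lebesgue_measure R).
Local Notation I01 := (`[0%R, 1%R[%classic : set R).

Definition circle_prob : set (measurableTypeR R) -> \bar R := circle_measure R.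

HB.instance Definition _ := Measure.on circle_prob.

Lemma circle_prob_setT : circle_prob setT = 1%E.
Proof.
rewrite /circle_prob /circle_measure /= /mfrestr /mrestr setTI.
by rewrite lebesgue_measure_itv/= lte_fin ltr01 oppr0 adde0.
Qed.

HB.instance Definition _ :=
  Measure_isProbability.Build _ _ _ circle_prob circle_prob_setT.

Lemma circle_probE A : circle_prob A = mu (A `&` I01).
Proof. by []. Qed.

Lemma circle_prob_setC : circle_prob (~` I01) = 0%E.
Proof. by rewrite circle_probE setICl measure0. Qed.

Lemma integral_circle_prob (f : R -> R) : circle_prob.-integrable setT (EFin \o f) ->
  \int[circle_prob]_x f x = \int[mu]_(x in I01) f x.
Proof.
move=> intf; rewrite /Rintegral; congr fine.
rewrite (@negligible_integral _ _ _ circle_prob setT (~` I01))//.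
- rewrite setTD setCK; apply: eq_measure_integral => A mA AI.
  by rewrite /= circle_probE; congr (mu _); exact/setIidPl.
- by apply: measurableC; exact: measurable_itv.
- exact: circle_prob_setC.
Qed.

Lemma measurable_affine (a c : R) : measurable_fun setT (fun t => a * t + c).
Proof. by apply: measurable_funD => //; exact: measurable_funM. Qed.

Lemma FTC_everywhere (F f : R -> R) (a b : R) : a < b ->
  (forall x : R, is_derive x 1 F (f x)) -> continuous f ->
  \int[mu]_(x in `[a, b]) f x = F b - F a.
Proof.
move=> ab dF cf.
have cF : continuous F.
  by move=> x; apply/differentiable_continuous/derivable1_diffP; case: (dF x).
rewrite /Rintegral (continuous_FTC2 (F := F))//.
- exact: continuous_subspaceT.
- split; first by move=> x _; case: (dF x).
  + exact/cvg_at_right_filter/cF.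
  + exact/cvg_at_left_filter/cF.
- by move=> x _; rewrite derive1E; case: (dF x).
Qed.

Lemma is_derive_sin_affine (a c x : R) :
  is_derive x 1 (fun t => sin (a * t + c)) (cos (a * x + c) * a).
Proof.
apply: (@is_derive1_comp R sin (fun t => a * t + c)).
by apply: is_derive_eq; rewrite addr0 -[RHS]mulr1.
Qed.

Lemma is_derive_cos_affine (a c x : R) :
  is_derive x 1 (fun t => cos (a * t + c)) (- sin (a * x + c) * a).
Proof.
apply: (@is_derive1_comp R cos (fun t => a * t + c)).
by apply: is_derive_eq; rewrite addr0 -[RHS]mulr1.
Qed.

Lemma continuous_cos_affine (a c : R) : continuous (fun t => cos (a * t + c)).
Proof.
by move=> x; apply/differentiable_continuous/derivable1_diffP;
  case: (is_derive_cos_affine a c x).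
Qed.

Lemma integral_circle_cos (a c : R) : a != 0 ->
  \int[circle_prob]_t cos (a * t + c) = (sin (a + c) - sin c) / a.
Proof.
move=> a0.
have bc := bddmeas_cos (measurable_affine a c).
rewrite integral_circle_prob; last exact: bddmeas_integrable.
rewrite /Rintegral integral_itv_bndo_bndc//; last first.
  by apply/measurable_EFinP; apply: measurable_funS (proj1 bc).
rewrite -/(Rintegral mu `[0, 1] (fun t => cos (a * t + c))).
have dF (x : R) : is_derive x 1 (fun t => a^-1 * sin (a * t + c)) (cos (a * x + c)).
  have := is_deriveZ a^-1 (is_derive_sin_affine a c x).
  by congr is_derive; rewrite /GRing.scale/= mulrCA mulVf// mulr1.
rewrite (FTC_everywhere _ dF)//; last exact: continuous_cos_affine.
by rewrite !(mulr0, mulr1, add0r) -mulrBr mulrC.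
Qed.

End circle_prob.

Section bc_functional_cos.
Context d (T : measurableType d) (R : realType).
Implicit Type L : (T -> R) -> R.

(** The form of the principle used when the trigonometric sets generate the
    whole sigma-algebra. *)
Lemma bc_functional_cos_eq0 L (Phi : set (T -> R)) :
  bc_functional L ->
  (forall phi, Phi phi -> measurable_fun setT phi) ->
  (forall phi psi, Phi phi -> Phi psi -> Phi (fun x => phi x - psi x)) ->
  (forall c, Phi (fun=> c)) ->
  (forall phi, Phi phi -> L (fun x => cos (phi x)) = 0) ->
  (forall A : set T, d.-measurable A ->
    measurable (A : set (g_sigma_algebraType (trig_sets Phi)))) ->
  forall g, bddmeas g -> L g = 0.
Proof.
move=> bcL mPhi PhiB Phic Lcos gen; apply: bc_functional_eq0 => // A mA.
by have [] := trig_determination bcL mPhi PhiB Phic Lcos (gen _ mA).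
Qed.

End bc_functional_cos.

Section real_line.
Context (R : realType).
Local Notation T := (measurableTypeR R).

Definition affine_phases : set (T -> R) :=
  [set phi | exists a c, phi = fun t => a * t + c].

Lemma bc_functional_affine_eq0 (L : (T -> R) -> R) : bc_functional L ->
  (forall a c, L (fun t => cos (a * t + c)) = 0) ->
  forall g, bddmeas g -> L g = 0.
Proof.
move=> bcL Lcos.
have PhiB phi psi : affine_phases phi -> affine_phases psi ->
    affine_phases (fun x => phi x - psi x).
  move=> [a [c ->]] [a' [c' ->]]; exists (a - a'), (c - c').
  by apply/funext => x; ring.
have Phic c : affine_phases (fun=> c).
  by exists 0, c; apply/funext => x; rewrite mul0r add0r.
apply: (bc_functional_cos_eq0 (Phi := affine_phases)) => //.
- by move=> _ [a [c ->]]; exact: measurable_affine.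
- by move=> _ [a [c ->]].
- move=> A mA.
  have := measurable_trig_phase (T := T) (phi := fun x : T => x) PhiB Phic _ measurableT mA.
  rewrite setTI; apply => n; exists n.+1%:R^-1, 0.
  by apply/funext => x; rewrite addr0 mulrC.
Qed.

Definition affine2_phases : set (T * T -> R) :=
  [set phi | exists a b c, phi = fun z => a * z.1 + b * z.2 + c].

Lemma measurable_affine2 a b c :
  measurable_fun setT (fun z : T * T => a * z.1 + b * z.2 + c).
Proof.
by apply: measurable_funD => //; apply: measurable_funD;
  exact: measurable_funM.
Qed.

Lemma bc_functional_affine2_eq0 (L : (T * T -> R) -> R) : bc_functional L ->
  (forall a b c, L (fun z => cos (a * z.1 + b * z.2 + c)) = 0) ->
  forall g, bddmeas g -> L g = 0.
Proof.
move=> bcL Lcos.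
have PhiB phi psi : affine2_phases phi -> affine2_phases psi ->
    affine2_phases (fun x => phi x - psi x).
  move=> [a [b [c ->]]] [a' [b' [c' ->]]]; exists (a - a'), (b - b'), (c - c').
  by apply/funext => x; ring.
have Phic c : affine2_phases (fun=> c).
  by exists 0, 0, c; apply/funext => x; ring.
apply: (bc_functional_cos_eq0 (Phi := affine2_phases)) => //.
- by move=> _ [a [b [c ->]]]; exact: measurable_affine2.
- by move=> _ [a [b [c ->]]].
- move=> A mA.
  have mid : measurable_fun (setT : set (g_sigma_algebraType (trig_sets affine2_phases)))
      (fun z : T * T => z).
    apply/measurable_fun_pairP; split; apply: measurable_trig_phase => // n.
    + exists n.+1%:R^-1, 0, 0; apply/funext => z /=; ring.
    + exists 0, n.+1%:R^-1, 0; apply/funext => z /=; ring.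
  by have := mid measurableT A mA; rewrite setTI.
Qed.

End real_line.

Section uniform_split.
Context (R : realType).
Local Notation T := (measurableTypeR R).
Local Notation P := (@circle_prob R).

(** By [bc_functional_affine_eq0], it suffices to compare the integrals of
    cosines, which are explicit. *)
Lemma circle_prob_halves (g : T -> R) : bddmeas g ->
  \int[P]_x g x = 2^-1 * (\int[P]_x g (2^-1 * x + 0) + \int[P]_x g (2^-1 * x + 2^-1)).
Proof.
move=> bg.
pose I (g : T -> R) := \int[P]_x g x.
have bcI : bc_functional I by exact: Rintegral_bc_functional.
pose J b (g : T -> R) := \int[P]_x g (2^-1 * x + b).
have bcJ b : bc_functional (J b).
  exact: (@bc_functional_comp _ T R _ T I (fun x : T => 2^-1 * x + b) bcI
    (@measurable_affine R 2^-1 b)).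
have bcL := bc_functionalZD (- 2^-1) (bcJ 0) (bc_functionalZD (- 2^-1) (bcJ 2^-1) bcI).
have solve (i j k : R) : - 2^-1 * i + (- 2^-1 * j + k) = 0 -> k = 2^-1 * (i + j).
  by lra.
apply: solve; rewrite -/(J 0 g) -/(J 2^-1 g) -/(I g).
apply: (bc_functional_affine_eq0 bcL) => // a c; rewrite /J /I.
have [->|a0] := eqVneq a 0.
  have E0 (u : T -> R) : \int[P]_x cos (0 * u x + c) = \int[P]_x cos c.
    by apply: eq_Rintegral => x _; rewrite mul0r add0r.
  by rewrite (E0 (fun x => 2^-1 * x + 0)) (E0 (fun x => 2^-1 * x + 2^-1)) (E0 id); field.
have E b : \int[P]_x cos (a * (2^-1 * x + b) + c) =
    (sin (a / 2 + (a * b + c)) - sin (a * b + c)) / (a / 2).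
  rewrite -integral_circle_cos ?mulf_neq0 ?invr_eq0//.
  by apply: eq_Rintegral => x _; congr cos; ring.
rewrite !E integral_circle_cos// mulr0 add0r.
have -> : a / 2 + (a / 2 + c) = a + c by field.
by field.
Qed.

End uniform_split.

Section cos_bounds.
Context (R : realType).

Lemma cos_lipschitz (x y : R) : `|cos x - cos y| <= `|x - y|.
Proof.
wlog xy : x y / y <= x.
  by move=> H; have [/H//|/ltW/H] := leP y x; rewrite distrC [leRHS]distrC.
have ccos : {within `[y, x], continuous (@cos R)}.
  exact/continuous_subspaceT/continuous_cos.
have [z _ ->] := MVT_segment xy (fun z _ => is_derive_cos z) ccos.
by rewrite normrM ler_piMl// normrN sin_max.
Qed.

End cos_bounds.

Section binary_digits.
Context (R : realType).
Local Notation T := (measurableTypeR R).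
Local Notation P := (@circle_prob R).

Definition bit (u : T) : R := (2^-1 <= u)%R%:R.

Definition dbl (u : T) : T := 2 * u - bit u.

Lemma measurable_bit : measurable_fun setT bit.
Proof.
have -> : bit = \1_(`[2^-1, +oo[ : set R).
  apply/funext => u; rewrite indicE /bit; congr (_%:R); congr nat_of_bool.
  by apply/idP/idP => [H|/set_mem/=]; [apply/mem_set => /=|]; rewrite in_itv/= andbT.
by apply: measurable_indic; exact: measurable_itv.
Qed.

Lemma measurable_dbl : measurable_fun setT dbl.
Proof.
apply: measurable_funB; last exact: measurable_bit.
exact: measurable_funM.
Qed.

(** The first binary digit of a uniform point is a fair coin, independent of
    the uniform point formed by the other digits. *)
Lemma integral_bit_dbl (g : R -> T -> R) :
  (forall b, bddmeas (g b)) -> bddmeas (fun u => g (bit u) (dbl u)) ->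
  \int[P]_u g (bit u) (dbl u) = 2^-1 * (\int[P]_u g 0 u + \int[P]_u g 1 u).
Proof.
move=> bg bgu; rewrite (circle_prob_halves bgu).
have m0 := bddmeas_comp (measurable_affine 2^-1 0) bgu.
have m1 := bddmeas_comp (measurable_affine 2^-1 2^-1) bgu.
congr (_ * (_ + _)); rewrite !integral_circle_prob; try exact: bddmeas_integrable.
  apply: eq_Rintegral => u; rewrite inE/= in_itv/= => /andP[u0 u1].
  have -> : bit (2^-1 * u + 0) = 0 by rewrite /bit leNgt (_ : _ < _)//; lra.
  by congr g; rewrite /dbl /bit leNgt (_ : _ < _)/=; lra.
apply: eq_Rintegral => u; rewrite inE/= in_itv/= => /andP[u0 u1].
have -> : bit (2^-1 * u + 2^-1) = 1 by rewrite /bit (_ : _ <= _)//; lra.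
by congr g; rewrite /dbl /bit (_ : _ <= _)/=; lra.
Qed.

(** The truncations of the number whose binary digits are those of even rank of
    u, the first digit having rank 0. *)
Fixpoint even_digits_approx n (u : T) : R :=
  if n is m.+1 then 2^-1 * (bit u + even_digits_approx m (dbl (dbl u))) else 0.

Lemma bit01 u : 0 <= bit u <= 1.
Proof. by rewrite /bit; case: (2^-1 <= u)%R; rewrite ?lexx ler01. Qed.

Lemma even_digits_approx01 n u : 0 <= even_digits_approx n u <= 1.
Proof.
elim: n u => [|n IH] u /=; first by rewrite lexx ler01.
have /andP[? ?] := IH (dbl (dbl u)); have /andP[? ?] := bit01 u.
by apply/andP; split; lra.
Qed.

Lemma nd_even_digits_approx u : nondecreasing_seq (even_digits_approx ^~ u).
Proof.
apply/nondecreasing_seqP => n; elim: n u => [|n IH] u.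
  by have /andP[] := even_digits_approx01 1 u.
have EE m v : even_digits_approx m.+1 v =
    2^-1 * (bit v + even_digits_approx m (dbl (dbl v))) by [].
by rewrite [leLHS]EE [leRHS]EE; have := IH (dbl (dbl u)); lra.
Qed.

Lemma measurable_even_digits_approx n : measurable_fun setT (even_digits_approx n).
Proof.
elim: n => [|n IH] //=.
apply: measurable_funM => //; apply: measurable_funD; first exact: measurable_bit.
apply: (measurableT_comp IH); apply: (measurableT_comp measurable_dbl).
exact: measurable_dbl.
Qed.

Definition even_digits (u : T) : R := limn (even_digits_approx ^~ u).
Definition odd_digits (u : T) : R := even_digits (dbl u).

Lemma cvg_even_digits u : even_digits_approx n u @[n --> \oo] --> even_digits u.
Proof.
apply: nondecreasing_is_cvgn; first exact: nd_even_digits_approx.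
by exists 1 => _ [n _ <-]; have /andP[] := even_digits_approx01 n u.
Qed.

Lemma measurable_even_digits : measurable_fun setT even_digits.
Proof.
apply: measurable_fun_cvg measurable_even_digits_approx _ => u _.
exact: cvg_even_digits.
Qed.

Lemma measurable_odd_digits : measurable_fun setT odd_digits.
Proof. exact: measurableT_comp measurable_even_digits measurable_dbl. Qed.

Lemma even_digits01 u : 0 <= even_digits u <= 1.
Proof.
apply/andP; split.
  apply: limr_ge; first exact: cvg_even_digits.
  by apply: nearW => n; have /andP[] := even_digits_approx01 n u.
apply: limr_le; first exact: cvg_even_digits.
by apply: nearW => n; have /andP[] := even_digits_approx01 n u.
Qed.

(** Together with the definition of [odd_digits], this expresses the pair of
    [even_digits] and [odd_digits] at u by the same pair at [dbl u] and the
    first digit. *)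
Lemma even_digitsE u : even_digits u = 2^-1 * (bit u + odd_digits (dbl u)) :> R.
Proof.
have := @cvg_even_digits u; rewrite -cvg_shiftS => H.
apply: (cvg_unique _ H) => //=.
apply: cvgM; first exact: cvg_cst.
by apply: cvgD; [exact: cvg_cst|exact: cvg_even_digits].
Qed.

End binary_digits.

Section product_probability.
Context d1 d2 (T1 : measurableType d1) (T2 : measurableType d2) (R : realType).
Variables (P1 : probability T1 R) (P2 : probability T2 R).

Definition prod_prob : probability (T1 * T2)%type R := (P1 \x P2)%E.

Implicit Type g : T1 * T2 -> R.

Lemma bddmeas_pair1 g x : bddmeas g -> bddmeas (fun y => g (x, y)).
Proof. by move=> bg; apply: (bddmeas_comp _ bg); exact: pair1_measurable. Qed.

Lemma bddmeas_pair2 g y : bddmeas g -> bddmeas (fun x => g (x, y)).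
Proof. by move=> bg; apply: (bddmeas_comp _ bg); exact: pair2_measurable. Qed.

Lemma Rintegral_probability_cst d (T : measurableType d) (P : probability T R) (c : R) :
  \int[P]_x c = c.
Proof.
by rewrite Rintegral_cst// -[LHS]/(c * fine (P setT)) probability_setT mulr1.
Qed.

Lemma normr_Rintegral_le d (T : measurableType d) (P : probability T R) (g : T -> R) C :
  measurable_fun setT g -> (forall x, `|g x| <= C) -> `|\int[P]_x g x| <= C.
Proof.
move=> mg gC; have bg : bddmeas g by split=> //; exists C.
apply: (le_trans (le_normr_Rintegral measurableT (bddmeas_integrable P bg))).
have bn : bddmeas (fun x => `|g x|).
  by split; [exact: measurableT_comp|exists C => x; rewrite normr_id].
apply: (le_trans (le_Rintegral measurableT (bddmeas_integrable P bn)
  (bddmeas_integrable P (bddmeas_cst T C)) (fun x _ => gC x))).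
by rewrite Rintegral_probability_cst.
Qed.

Lemma Rintegral_prod1 g : bddmeas g ->
  \int[prod_prob]_z g z = \int[P1]_x \int[P2]_y g (x, y).
Proof.
move=> bg; have ig := bddmeas_integrable prod_prob bg.
rewrite /Rintegral -integral12_prod_meas1//; congr fine.
apply: eq_integral => x _; rewrite /fubini_F /= fineK//.
exact: integrable_fin_num (bddmeas_integrable P2 (bddmeas_pair1 x bg)).
Qed.

Lemma Rintegral_prod2 g : bddmeas g ->
  \int[prod_prob]_z g z = \int[P2]_y \int[P1]_x g (x, y).
Proof.
move=> bg; have ig := bddmeas_integrable prod_prob bg.
rewrite /Rintegral -integral21_prod_meas1//; congr fine.
apply: eq_integral => y _; rewrite /fubini_G /= fineK//.
exact: integrable_fin_num (bddmeas_integrable P1 (bddmeas_pair2 y bg)).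
Qed.

Lemma bddmeas_Rintegral2 g : bddmeas g ->
  bddmeas (fun x => \int[P2]_y g (x, y)).
Proof.
move=> bg; have ig := bddmeas_integrable prod_prob bg.
have [mg [C gC]] := bg; split; last first.
  exists C => x; apply: normr_Rintegral_le => //.
  by case: (bddmeas_pair1 x bg).
apply/measurable_EFinP.
rewrite (_ : _ \o _ = fubini_F P2 (EFin \o g)).
  exact: (@measurable_fubini_F _ _ _ _ _ P1 P2 _ ig).
apply/funext => x; rewrite /= fineK//.
exact: integrable_fin_num (bddmeas_integrable P2 (bddmeas_pair1 x bg)).
Qed.

End product_probability.

Section digits_independent.
Context (R : realType).
Local Notation T := (measurableTypeR R).
Local Notation P := (@circle_prob R).
Local Notation A := (@even_digits R).
Local Notation B := (@odd_digits R).

Lemma bddmeas_cos_affine2 (a b c : R) :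
  bddmeas (fun z : T * T => cos (a * z.1 + b * z.2 + c)).
Proof. by apply: bddmeas_cos; exact: measurable_affine2. Qed.

Lemma measurable_digits : measurable_fun setT (fun u : T => (A u, B u) : T * T).
Proof.
by apply: measurable_fun_pair; [exact: measurable_even_digits|exact: measurable_odd_digits].
Qed.

(** Removing one digit gives E and I the same functional equation; it maps
    (a, b) to (b, a / 2) and so contracts the norm |a| + (3/2) |b| by the factor
    3/4. Since E and I are both close to cos c for small a and b, they agree. *)
Let E a b c := \int[P]_u cos (a * A u + b * B u + c).
Let I a b c := \int[prod_prob P P]_z cos (a * z.1 + b * z.2 + c).

Let EE a b c : E a b c = 2^-1 * (E b (a / 2) c + E b (a / 2) (c + a / 2)).
Proof.
rewrite /E.
have bz (b' c' : R) := bddmeas_comp measurable_digits (bddmeas_cos_affine2 b b' c').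
have := integral_bit_dbl (g := fun s v => cos (b * A v + a / 2 * B v + (c + a / 2 * s))).
rewrite mulr0 addr0 mulr1 => <-.
- apply: eq_Rintegral => u _; congr cos.
  by rewrite even_digitsE [B u]/odd_digits; field.
- by move=> s; exact: bz.
- apply: bddmeas_cos.
  have [mbit mdbl] := (@measurable_bit R, @measurable_dbl R).
  have [mA mB] := (@measurable_even_digits R, @measurable_odd_digits R).
  by apply: measurable_funD; apply: measurable_funD => //; apply: measurable_funM => //;
    exact: measurableT_comp.
Qed.

Let II a b c : I a b c = 2^-1 * (I b (a / 2) c + I b (a / 2) (c + a / 2)).
Proof.
have H a' b' c' := bddmeas_cos_affine2 a' b' c'.
rewrite /I Rintegral_prod1// !Rintegral_prod2//.
rewrite (circle_prob_halves (bddmeas_Rintegral2 P P (H a b c))) /=.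
congr (_ * (_ + _)); apply: eq_Rintegral => x _; apply: eq_Rintegral => y _; congr cos.
  by field.
by field.
Qed.

Let near_cos (a b c x y : R) : 0 <= x <= 1 -> 0 <= y <= 1 ->
  `|cos (a * x + b * y + c) - cos c| <= `|a| + `|b|.
Proof.
move=> /andP[x0 x1] /andP[y0 y1]; apply: (le_trans (cos_lipschitz _ _)).
by rewrite addrK (le_trans (ler_normD _ _))// !normrM lerD// ler_piMr// ger0_norm.
Qed.

Let normr_RintegralB (g : T -> R) (r C : R) : bddmeas g ->
  (forall x, `|g x - r| <= C) -> `|\int[P]_x g x - r| <= C.
Proof.
move=> bg gC.
have -> : \int[P]_x g x - r = \int[P]_x (g x - r).
  rewrite RintegralB ?Rintegral_probability_cst//.
  - exact: bddmeas_integrable bg.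
  - exact: bddmeas_integrable (bddmeas_cst _ _).
by apply: normr_Rintegral_le => //; apply: measurable_funB => //; case: bg.
Qed.

Let EI_near a b c : `|E a b c - I a b c| <= 2 * (`|a| + 3 / 2 * `|b|).
Proof.
have Ec : `|E a b c - cos c| <= `|a| + `|b|.
  apply: normr_RintegralB => [|u].
    exact: (bddmeas_comp measurable_digits (bddmeas_cos_affine2 a b c)).
  by apply: near_cos; exact: even_digits01.
have Ic : `|I a b c - cos c| <= `|a| + `|b|.
  (* the coordinates lie in the unit interval almost surely *)
  pose k (x : T) : T := x * \1_(`[0%R, 1%R[%classic : set R) x.
  have mk : measurable_fun setT k.
    by apply: measurable_funM => //; apply: measurable_indic; exact: measurable_itv.
  have k01 x : 0 <= (k x : R) <= 1.
    rewrite /k indicE; case: (boolP (x \in _)) => [|_]; last by rewrite mulr0 lexx ler01.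
    by rewrite inE/= in_itv/= mulr1 => /andP[-> /ltW ->].
  have kE (g : T -> R) : bddmeas g -> \int[P]_x g x = \int[P]_x g (k x).
    move=> bg; rewrite !integral_circle_prob; last 2 first.
    - exact: bddmeas_integrable (bddmeas_comp mk bg).
    - exact: bddmeas_integrable bg.
    by apply: eq_Rintegral => x xI; rewrite /k indicE xI mulr1.
  have H := bddmeas_cos_affine2 a b c.
  rewrite /I Rintegral_prod1// (kE _ (bddmeas_Rintegral2 P P H)).
  apply: normr_RintegralB => [|x].
    exact: (bddmeas_comp mk (bddmeas_Rintegral2 P P H)).
  rewrite (kE _ (bddmeas_pair1 (k x) H)); apply: normr_RintegralB => [|y].
    exact: (bddmeas_comp mk (bddmeas_pair1 (k x) H)).
  exact: (near_cos a b c (k01 x) (k01 y)).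
have := ler_distD (cos c) (E a b c) (I a b c).
rewrite (distrC (cos c)); have := normr_ge0 b; lra.
Qed.

Let EI a b c : E a b c = I a b c.
Proof.
have decay n : forall a b c,
    `|E a b c - I a b c| <= 2 * (`|a| + 3 / 2 * `|b|) * (3 / 4) ^+ n.
  elim: n => [|n IH] {}a {}b {}c; first by rewrite expr0 mulr1; exact: EI_near.
  rewrite EE II -mulrBr opprD addrACA normrM ger0_norm//.
  have := ler_normD (E b (a / 2) c - I b (a / 2) c)
    (E b (a / 2) (c + a / 2) - I b (a / 2) (c + a / 2)).
  have := IH b (a / 2) c; have := IH b (a / 2) (c + a / 2).
  have q0 : 0 <= (3 / 4) ^+ n :> R by apply: exprn_ge0; lra.
  have -> : `|a / 2| = `|a| / 2 by rewrite normrM [X in _ * X]ger0_norm.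
  rewrite exprS; have := mulr_ge0 (normr_ge0 b) q0; have := mulr_ge0 (normr_ge0 a) q0.
  set q := (_ ^+ n); nra.
apply/eqP; rewrite -subr_eq0 -normr_le0.
have cv : (fun n => 2 * (`|a| + 3 / 2 * `|b|) * (3 / 4) ^+ n) @ \oo --> (0 : R).
  by apply: cvg_geometric; rewrite ger0_norm; lra.
apply: (cvgr_to_ge cv).
by apply: nearW => n; exact: decay.
Qed.

(** The digits of even rank and those of odd rank form two independent uniform
    points. *)
Theorem digits_independent (g : T * T -> R) : bddmeas g ->
  \int[P]_u g (A u, B u) = \int[P]_x \int[P]_y g (x, y).
Proof.
move=> bg; rewrite -Rintegral_prod1//; apply/eqP; rewrite -subr_eq0; apply/eqP.
pose L (g : T * T -> R) := \int[P]_u g (A u, B u) - \int[prod_prob P P]_z g z.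
have bcL : bc_functional L.
  apply: bc_functionalB; last exact: Rintegral_bc_functional.
  exact: (bc_functional_comp (Rintegral_bc_functional P) measurable_digits).
apply: (bc_functional_affine2_eq0 bcL) => // a b c.
by apply/eqP; rewrite subr_eq0; apply/eqP; exact: EI.
Qed.

End digits_independent.

(** * The Gaussian distribution *)
Section gaussian_integrals.
Context (R : realType).
Local Notation mu := (@lebesgue_measure R).
Local Notation w := (@normal_pdf R 0 1).

Let k := @normal_peak R 1.

Let wE x : w x = k * expR (2^-1 * - x ^+ 2).
Proof.
rewrite normal_pdfE ?oner_neq0//= /normal_fun subr0 expr1n; congr (_ * expR _).
by rewrite mulrC.
Qed.

Let k0 : 0 < k. Proof. by apply: normal_peak_gt0; exact: oner_neq0. Qed.

Let w0 x : 0 <= w x. Proof. exact: normal_pdf_ge0. Qed.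

Let is_derive_w (x : R) : is_derive x 1 w (- x * w x).
Proof.
have dsq : is_derive x 1 (fun y : R => 2^-1 * - y ^+ 2) (- x).
  apply: is_derive_eq. by rewrite /GRing.scale/=; field.
have := is_deriveZ k (is_derive1_comp (is_derive_expR _) dsq).
rewrite (_ : k \*: _ = w); last by apply/funext => y; rewrite wE.
by move=> H; apply: is_derive_eq; rewrite wE /GRing.scale/=; ring.
Qed.

Let cw : continuous w.
Proof. by apply: continuous_normal_pdf; exact: oner_neq0. Qed.

Let intw : mu.-integrable setT (EFin \o w).
Proof. exact: integrable_normal_pdf. Qed.

Let mw : measurable_fun setT w.
Proof. exact: measurable_normal_pdf. Qed.

(** |x| exp (- x^2 / 2) <= exp (- x^2 / 4), and the right-hand side is
    proportional to the Gaussian density of variance 2. *)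
Let intxw : mu.-integrable setT (EFin \o (fun x => x * w x)).
Proof.
have s0 : Num.sqrt 2 != 0 :> R by rewrite sqrtr_eq0 -ltNge.
pose k2 := @normal_peak R (Num.sqrt 2).
have k20 : 0 < k2 by exact: normal_peak_gt0.
have int2 := integrableZl measurableT (k / k2) (integrable_normal_pdf 0 (@Num.sqrt R 2)).
apply: (le_integrable measurableT _ _ int2).
  apply/measurable_EFinP; apply: measurable_funM => //.
move=> x _; rewrite /= lee_fin normrM (ger0_norm (w0 x)).
rewrite [leRHS]ger0_norm ?mulr_ge0 ?normal_pdf_ge0 ?invr_ge0 ?(ltW k0) ?(ltW k20)//.
rewrite wE normal_pdfE//= /normal_fun -/k2 subr0 sqr_sqrtr// [leRHS]mulrA divfK ?gt_eqF//.
rewrite mulrCA ler_wpM2l ?(ltW k0)//.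
have -> : 2^-1 * - x ^+ 2 = - x ^+ 2 / (2 *+ 2) + - (x ^+ 2 / 4).
  by rewrite -mulr_natr; field.
rewrite expRD mulrCA ler_piMr ?expR_ge0// expRN ler_pdivrMr ?expR_gt0// mul1r.
apply: le_trans (expR_ge1Dx _).
have : 0 <= (`|x| / 2 - 1) ^+ 2 by exact: sqr_ge0.
have : `|x| ^+ 2 = x ^+ 2 by rewrite real_normK// num_real.
by nra.
Qed.

Let int_bw (g : R -> R) : bddmeas (g : measurableTypeR R -> R) ->
  mu.-integrable setT (EFin \o (fun x => g x * w x)).
Proof. by move=> bg; exact: (bddmeas_integrableM bg intw). Qed.

Let int_bxw (g : R -> R) : bddmeas (g : measurableTypeR R -> R) ->
  mu.-integrable setT (EFin \o (fun x => g x * (x * w x))).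
Proof. by move=> bg; exact: (bddmeas_integrableM bg intxw). Qed.

Let bddsin (a c : R) : bddmeas ((fun x => sin (a * x + c)) : measurableTypeR R -> R).
Proof.
have -> : (fun x => sin (a * x + c)) = fun x => cos (a * x + (c - pi / 2)).
  by apply/funext => x; rewrite addrA cosBpihalf.
by apply: bddmeas_cos; exact: measurable_affine.
Qed.

Let bddcosa (a c : R) : bddmeas ((fun x => cos (a * x + c)) : measurableTypeR R -> R).
Proof. by apply: bddmeas_cos; exact: measurable_affine. Qed.

(** The difference of the two sides is the integral of the derivative of
    sin (a x + c) w x, a function that vanishes at infinity. *)
Lemma normal_integration_by_parts (a c : R) :
  \int[mu]_x (sin (a * x + c) * (x * w x)) =
  a * \int[mu]_x (cos (a * x + c) * w x).
Proof.
pose h x := sin (a * x + c) * w x.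
pose h' x := a * (cos (a * x + c) * w x) - sin (a * x + c) * (x * w x).
have inth' : mu.-integrable setT (EFin \o h').
  apply: eq_integrable (integrableB measurableT
    (integrableZl measurableT a (int_bw (bddcosa a c))) (int_bxw (bddsin a c))) => //.
suff : \int[mu]_x h' x = 0.
  rewrite RintegralB ?RintegralZl//; [|exact: int_bw
    |exact: eq_integrable (integrableZl measurableT a (int_bw (bddcosa a c)))
    |exact: int_bxw].
  by move/eqP; rewrite subr_eq0 => /eqP.
have dh (x : R) : is_derive x 1 h (h' x).
  have := is_deriveM (is_derive_sin_affine a c x) (is_derive_w x).
  by congr is_derive; rewrite /GRing.scale/= /h'; ring.
have ch' : continuous h'.
  have csin : continuous (fun x => sin (a * x + c)).
    by move=> x; apply/differentiable_continuous/derivable1_diffP;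
      case: (is_derive_sin_affine a c x).
  move=> x; apply: cvgB.
    apply: cvgM; first exact: cvg_cst.
    by apply: cvgM; [exact: continuous_cos_affine|exact: cw].
  by apply: cvgM; [exact: csin|apply: cvgM; [exact: cvg_id|exact: cw]].
pose D n := `[- n.+1%:R, n.+1%:R]%classic : set R.
have cvD : \int[mu]_x (\1_(D n) x * h' x) @[n --> \oo] --> \int[mu]_x (1 * h' x).
  apply: (bc_cvg (integral_bc_functional inth')
    (g_ := fun n => \1_(D n)) (g := fun=> 1) (C := 1)).
  - by move=> n; apply: measurable_indic; exact: measurable_itv.
  - by move=> n x; rewrite indicE; case: (_ \in _); rewrite ?normr1 ?normr0.
  - move=> x; apply: (@cvg_near_cst); near=> n.
    rewrite indicE mem_set// /D /= in_itv/=.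
    rewrite -ler_norml; apply/ltW/(lt_le_trans (archi_boundP (normr_ge0 x))).
    rewrite ler_nat leqW//; near: n; exact: nbhs_infty_ge.
have w_le n : w n.+1%:R <= k * n.+1%:R^-1 /\ w (- n.+1%:R) <= k * n.+1%:R^-1.
  suff H (x : R) : x ^+ 2 = n.+1%:R ^+ 2 -> w x <= k * n.+1%:R^-1.
    by split; apply: H => //; rewrite sqrrN.
  move=> xn; rewrite wE ler_wpM2l ?(ltW k0)// mulrN expRN lef_pV2 ?posrE ?expR_gt0//.
  apply: le_trans (expR_ge1Dx _); rewrite xn.
  have := sqr_ge0 (n.+1%:R - 1 : R); nra.
have cv0 : \int[mu]_x (\1_(D n) x * h' x) @[n --> \oo] --> (0 : R).
  apply: norm_cvg0.
  have c0 : (fun n => 2 * k * n.+1%:R^-1) @ \oo --> (0 : R).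
    rewrite -[X in _ --> X](mulr0 (2 * k)).
    by apply: cvgM; [exact: cvg_cst|exact: cvg_harmonic].
  apply: (squeeze_cvgr _ (@cvg_cst _ _ _ _ _) c0).
  apply/nearW => n; rewrite normr_ge0/=.
  have -> : \int[mu]_x (\1_(D n) x * h' x) = h n.+1%:R - h (- n.+1%:R).
    have nn : - n.+1%:R < n.+1%:R :> R.
      by have : 0 < n.+1%:R :> R by []; lra.
    rewrite -(FTC_everywhere nn dh ch') [RHS]Rintegral_mkcond.
    apply: eq_Rintegral => x _; rewrite indicE patchE /D.
    by case: ifPn => _; rewrite ?mul1r ?mul0r.
  have hw x : `|h x| <= w x.
    by rewrite /h normrM (ger0_norm (w0 x)) ler_piMl// sin_max.
  apply: (le_trans (ler_normB _ _)); rewrite -mulrA mulr_natl mulr2n.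
  by have [wn wNn] := w_le n; rewrite lerD// (le_trans (hw _)).
have := cvg_unique _ cvD cv0; under eq_Rintegral do rewrite mul1r.
exact.
Unshelve. all: end_near. Qed.

Let is_derive_cf (c a : R) :
  is_derive a 1 (fun a => \int[mu]_x (cos (a * x + c) * w x))
    (- a * \int[mu]_x (cos (a * x + c) * w x)).
Proof.
pose f (a x : R) := cos (a * x + c) * w x.
have df (a' x : R) : is_derive a' 1 (f ^~ x) (- sin (a' * x + c) * (x * w x)).
  have := is_deriveZ (w x) (is_derive_cos_affine x c a').
  rewrite (_ : _ \*: _ = f ^~ x); last first.
    by apply/funext => y; rewrite /f [RHS]mulrC [y * x]mulrC.
  by move=> H; apply: is_derive_eq; rewrite /GRing.scale/= [x * a']mulrC; ring.
have p1f a' x : partial1of2 f a' x = - sin (a' * x + c) * (x * w x).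
  by rewrite partial1of2E; case: (df a' x).
have Ia : (`]a - 1, a + 1[%classic : set R) a.
  by rewrite /= in_itv/=; apply/andP; split; lra.
have intf x : (`]a - 1, a + 1[%classic : set R) x ->
    mu.-integrable setT (EFin \o f x).
  by move=> _; exact: int_bw (bddcosa x c).
have derf x y : (`]a - 1, a + 1[%classic : set R) x -> (setT : set R) y ->
    derivable (f ^~ y) x 1 by move=> _ _; case: (df x y).
have intG : mu.-integrable setT (EFin \o (fun x => `|x * w x|)).
  exact: integrable_abse intxw.
have boundG x y : (`]a - 1, a + 1[%classic : set R) x -> (setT : set R) y ->
    `|partial1of2 f x y| <= `|y * w y|.
  by move=> _ _; rewrite p1f normrM ler_piMl// normrN sin_max.
apply: DeriveDef.
  exact: (derivable_under_integral measurableT Ia intf derf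
    (fun y => normr_ge0 (y * w y)) intG boundG).
rewrite -derive1E (differentiation_under_integral measurableT Ia intf derf
    (fun y => normr_ge0 (y * w y)) intG boundG).
under eq_Rintegral do rewrite p1f mulNr -mulN1r.
rewrite RintegralZl//; last exact: int_bxw (bddsin a c).
by rewrite normal_integration_by_parts mulN1r mulNr.
Qed.

(** As a function of a, the integral K satisfies K' = - a K. *)
Theorem normal_cf (a c : R) :
  \int[mu]_x (cos (a * x + c) * w x) = cos c * expR (- (2^-1 * a ^+ 2)).
Proof.
pose Phi a := \int[mu]_x (cos (a * x + c) * w x).
pose K a := expR (2^-1 * a ^+ 2) * Phi a.
have dK (b : R) : is_derive b 1 K 0.
  have dsq : is_derive b 1 (fun y : R => 2^-1 * y ^+ 2) b.
    by apply: is_derive_eq; rewrite /GRing.scale/=; field.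
  have := is_deriveM (is_derive1_comp (is_derive_expR _) dsq) (is_derive_cf c b).
  move=> H; apply: is_derive_eq; rewrite /GRing.scale/=; ring.
have K0 : K 0 = cos c.
  rewrite /K expr0n mulr0 expR0 mul1r /Phi.
  under eq_Rintegral do rewrite mul0r add0r.
  rewrite RintegralZl// /Rintegral integral_normal_pdf/= mulr1//.
have := is_derive_0_is_cst a 0 dK; rewrite K0 /K -/(Phi a) => <-.
by rewrite mulrAC -expRD subrr expR0 mul1r.
Qed.

End gaussian_integrals.

Section quantile.
Context (R : realType).
Local Notation T := (measurableTypeR R).
Variable gam : probability T R.

Let idTR : T -> R := idfun.

#[local] HB.instance Definition _ :=
  @isMeasurableFun.Build _ _ _ _ idTR (@measurable_id _ _ setT).

Let X : {RV gam >-> R} := idTR.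

Let F (x : R) : R := fine (cdf X x).

Let FE x : (F x)%:E = gam `]-oo, x]%classic.
Proof. by rewrite /F fineK// /cdf fin_num_measure. Qed.

Let F_nd : {homo F : x y / x <= y}.
Proof.
move=> x y xy; apply: fine_le; rewrite ?fin_num_measure//.
exact: cdf_nondecreasing.
Qed.

Let F0 x : 0 <= F x.
Proof. by apply: fine_ge0; exact: cdf_ge0. Qed.

Let F1 x : F x <= 1.
Proof. by rewrite -lee_fin FE; exact: probability_le1. Qed.

(** The infimum is meaningful only inside the unit interval; the value 0
    elsewhere concerns a null set of the uniform distribution. *)
Definition quantile (u : T) : T :=
  if (0 < (u : R) < 1)%R then inf [set x | u <= F x] else 0.

(** Right continuity of F gives the direct implication. *)
Let quantile_le (u : R) x : 0 < u < 1 -> (quantile u <= x :> R) = (u <= F x).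
Proof.
move=> u01; rewrite /quantile u01; have /andP[u0 u1] := u01.
have nonempty : [set x | u <= F x] !=set0.
  have F_y1 : F @ +oo%R --> (1 : R) by apply: fine_cvg; exact: cvg_cdfy1.
  have /cvgrPdist_lt/(_ (1 - u)) := F_y1.
  move=> /(_ _)/wrap[|H]; first by rewrite subr_gt0.
  have : \forall y \near +oo%R, u <= F y.
    near=> y; have : `|1 - F y| < 1 - u by near: y; exact: H.
    by rewrite ger0_norm ?subr_ge0//; lra.
  by move=> /filter_ex.
have bounded : has_lbound [set x | u <= F x].
  have F_Ny0 : F @ -oo%R --> (0 : R) by apply: fine_cvg; exact: cvg_cdfNy0.
  have /cvgrPdist_lt/(_ u u0) H := F_Ny0.
  have : \forall y \near -oo%R, F y < u.
    near=> y; have : `|0 - F y| < u by near: y; exact: H.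
    by rewrite sub0r normrN ger0_norm.
  move=> /filter_ex[y Fyu]; exists y => z /= uFz; rewrite leNgt; apply/negP => zy.
  by have := F_nd (ltW zy); lra.
apply/idP/idP => [|uFx]; last exact: ge_inf.
apply: contraTT; rewrite -!ltNge => Fxu.
have rc : F y @[y --> x^'+] --> F x.
  apply: fine_cvg; rewrite fineK ?fin_num_measure//.
  exact: cdf_right_continuous.
have /cvgrPdist_lt/(_ (u - F x)) := rc.
move=> /(_ _)/wrap[|H]; first by rewrite subr_gt0.
have : \forall y \near x^'+, x < y /\ F y < u.
  near=> y; split; first by near: y; exact: nbhs_right_gt.
  have : `|F x - F y| < u - F x by near: y; exact: H.
  by rewrite distrC => /(le_lt_trans (ler_norm _)); lra.
move=> /filter_ex[y [xy Fyu]]; apply: (lt_le_trans xy).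
apply: lb_le_inf => // z /= uFz; rewrite leNgt; apply/negP => zy.
by have := F_nd (ltW zy); lra.
Unshelve. all: end_near. Qed.

Let preimage_quantile x : quantile @^-1` `]x, +oo[ =
  `]F x, 1[ `|` (if x < 0 then ~` `]0, 1[ else set0).
Proof.
apply/seteqP; split=> u /=; rewrite !in_itv/= andbT.
  have [u01|u01] := boolP (0 < u < 1).
    rewrite ltNge quantile_le// -ltNge => Fu; left.
    by rewrite Fu; case/andP: u01.
  rewrite /quantile (negbTE u01) => ->; right => /=.
  by rewrite in_itv/=; exact/negP.
move=> [/andP[Fu u1]|].
  have u01 : 0 < u < 1 by rewrite u1 (le_lt_trans _ Fu).
  by rewrite ltNge quantile_le// -ltNge.
case: ifPn => // x0 /=; rewrite in_itv/= => /negP u01.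
by rewrite /quantile (negbTE u01).
Qed.

Lemma measurable_quantile : measurable_fun setT quantile.
Proof.
apply: (measurability _ (RGenOInfty.measurableE R)) => //.
move=> _ [_ [x ->] <-]; rewrite setTI preimage_quantile.
apply: measurableU; first exact: measurable_itv.
by case: ifPn => // _; apply: measurableC; exact: measurable_itv.
Qed.

HB.instance Definition _ :=
  @isMeasurableFun.Build _ _ _ _ quantile measurable_quantile.

Let circle_prob_gt x : 0 <= x <= 1 ->
  circle_prob (`]x, 1[%classic : set T) = (1 - x)%:E.
Proof.
move=> /andP[x0 x1]; rewrite circle_probE setIidl.
  rewrite lebesgue_measure_itv/= lte_fin; case: ltP => // x1'.
  by rewrite (@le_anti _ _ x 1) ?x1// subrr.
by move=> y /=; rewrite !in_itv/= => /andP[xy ->]; rewrite andbT (le_trans x0)// ltW.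
Qed.

Let quantile_law A : measurable A ->
  distribution (@circle_prob R) quantile A = gam A.
Proof.
move=> mA.
apply: (@measure_unique _ _ T (@RGenOInfty.G R) (fun n => `](- n%:R), +oo[%classic)) => //.
- exact: RGenOInfty.measurableE.
- move=> _ _ [x ->] [y ->]; exists (Num.max x y).
  by apply/seteqP; split=> z /=; rewrite !in_itv/= !andbT gt_max;
    [move=> [-> ->]|move/andP].
- by move=> n; exists (- n%:R).
- apply/seteqP; split=> // x _; exists (Num.bound `|x|) => //=.
  rewrite in_itv/= andbT ltrNl; apply: le_lt_trans (archi_boundP (normr_ge0 x)).
  by rewrite -normrN ler_norm.
- move=> _ [x ->].
  transitivity (circle_prob (quantile @^-1` `]x, +oo[)); first by [].
  rewrite preimage_quantile measureU0.
  + transitivity (1 - F x)%:E; first by apply: circle_prob_gt; rewrite F0 F1.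
    have -> : `]x, +oo[%classic = ~` `]-oo, x] by rewrite setCitvl.
    transitivity (1 - gam `]-oo, x]%classic)%E; first by rewrite -FE EFinB.
    by apply/esym/probability_setC; exact: measurable_itv.
  + exact: measurable_itv.
  + by case: ifPn => // _; apply: measurableC; exact: measurable_itv.
  + case: ifPn => // _.
    transitivity (1 - circle_prob (`]0%R, 1%R[%classic : set T))%E.
      by apply: probability_setC; exact: measurable_itv.
    have -> : circle_prob (`]0, 1[%classic : set T) = 1%E.
      by rewrite circle_prob_gt ?lexx ?ler01// subr0.
    by rewrite subee.
- by move=> n; apply: le_lt_trans (probability_le1 _ _) _; rewrite ?ltry.
Qed.

(** The quantile function transports the uniform distribution to [gam], because
    its superlevel sets are the intervals above the values of F. *)
Theorem integral_quantile (g : T -> R) : bddmeas g ->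
  \int[@circle_prob R]_u g (quantile u) = \int[gam]_x g x.
Proof.
move=> bg; apply/eqP; rewrite -subr_eq0; apply/eqP.
pose L (g : T -> R) := \int[@circle_prob R]_u g (quantile u) - \int[gam]_x g x.
have bcL : bc_functional L.
  apply: bc_functionalB; last exact: Rintegral_bc_functional.
  exact: (bc_functional_comp (Rintegral_bc_functional _) measurable_quantile).
apply: (bc_functional_eq0 bcL) => // A mA.
rewrite /L.
have -> : (fun u => \1_A (quantile u)) = \1_(quantile @^-1` A) :> (T -> R).
  by apply/funext => u; rewrite !indicE.
rewrite /Rintegral !integral_indic// ?setIT; last first.
  by have := measurable_quantile measurableT mA; rewrite setTI.
by apply/eqP; rewrite subr_eq0; apply/eqP; congr fine; exact: (quantile_law mA).
Qed.

End quantile.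

(** * A sequence of independent Gaussian variables *)
Section gaussian_sequence.
Context (R : realType).
Local Notation T := (measurableTypeR R).
Local Notation P := (@circle_prob R).
Local Notation mu := (@lebesgue_measure R).

Definition normal01 : probability T R := @normal_prob R 0 1.

Lemma integral_normal01 (g : T -> R) : bddmeas g ->
  \int[normal01]_x g x = \int[mu]_x (g x * normal_pdf 0 1 x).
Proof.
move=> bg; apply/eqP; rewrite -subr_eq0; apply/eqP.
pose L (g : T -> R) := \int[normal01]_x g x - \int[mu]_x (g x * normal_pdf 0 1 x).
have bcL : bc_functional L.
  apply: bc_functionalB; first exact: Rintegral_bc_functional.
  by apply: integral_bc_functional; exact: integrable_normal_pdf.
apply: (bc_functional_eq0 bcL) => // A mA; rewrite /L.
apply/eqP; rewrite subr_eq0; apply/eqP.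
rewrite /Rintegral integral_indic// setIT; congr fine.
rewrite /normal01 /= /normal_prob integral_mkcond; apply: eq_integral => x _.
by rewrite patchE indicE; case: ifPn => _; rewrite ?mul1r ?mul0r.
Qed.

Lemma integral_normal01_cos (a c : R) :
  \int[normal01]_x cos (a * x + c) = cos c * expR (- (2^-1 * a ^+ 2)).
Proof.
rewrite integral_normal01 ?normal_cf//.
by apply: bddmeas_cos; exact: measurable_affine.
Qed.

(** The uniform points attached to the successive indices use disjoint sets of
    digits of u: the even ranks, then the even ranks among the odd ones, etc. *)
Definition gaussian_seq k (u : T) : R :=
  quantile normal01 (even_digits (iter k (@odd_digits R : T -> T) u)).

Lemma measurable_gaussian_seq k : measurable_fun setT (gaussian_seq k).
Proof.
apply: (measurableT_comp (@measurable_quantile _ normal01)).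
apply: (measurableT_comp (@measurable_even_digits R)).
suff : measurable_fun setT (iter k (@odd_digits R : T -> T)) by [].
elim: k => [|k IH]; first exact: measurable_id.
rewrite (_ : iter k.+1 _ = (@odd_digits R : T -> T) \o iter k (@odd_digits R : T -> T))//.
apply: measurableT_comp; last exact: IH.
exact: (@measurable_odd_digits R).
Qed.

Lemma gaussian_seqS k u : gaussian_seq k.+1 u = gaussian_seq k (odd_digits u).
Proof. by rewrite /gaussian_seq iterSr. Qed.

Lemma measurable_gaussian_sum N (a : nat -> R) :
  measurable_fun setT (fun u => \sum_(k < N) a k * gaussian_seq k u).
Proof.
apply: measurable_sum => k.
by apply: measurable_funM => //; exact: measurable_gaussian_seq.
Qed.

(** By induction: the first variable depends on [even_digits u], and the others
    form the same sequence at [odd_digits u]. *)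
Theorem gaussian_seq_cf N (a : nat -> R) (c : R) :
  \int[P]_u cos (\sum_(k < N) a k * gaussian_seq k u + c) =
  cos c * expR (- (2^-1 * \sum_(k < N) a k ^+ 2)).
Proof.
elim: N a c => [|N IH] a c.
  rewrite big_ord0 mulr0 oppr0 expR0 mulr1.
  under eq_Rintegral do rewrite big_ord0 add0r.
  exact: Rintegral_probability_cst.
pose G (z : T * T) := cos (\sum_(k < N) a k.+1 * gaussian_seq k z.2 +
  (a 0%N * quantile normal01 z.1 + c)).
have bG : bddmeas G.
  apply: bddmeas_cos; apply: measurable_funD; last first.
    apply: measurable_funD => //; apply: measurable_funM => //.
    exact: measurableT_comp (@measurable_quantile _ normal01) _.
  exact: (measurableT_comp (measurable_gaussian_sum N (fun k => a k.+1))).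
transitivity (\int[P]_u G (even_digits u, odd_digits u)).
  apply: eq_Rintegral => u _; rewrite /G /=; congr cos.
  rewrite big_ord_recl/= addrA [X in _ = X + c]addrC; congr (_ + _ + c).
  by apply: eq_bigr => k _; rewrite gaussian_seqS.
rewrite digits_independent//.
transitivity (\int[P]_x (cos (a 0%N * quantile normal01 x + c) *
    expR (- (2^-1 * \sum_(k < N) a k.+1 ^+ 2)))).
  by apply: eq_Rintegral => x _; rewrite -(IH (fun k => a k.+1)); exact: eq_Rintegral.
rewrite RintegralZr//; last first.
  apply: bddmeas_integrable; apply: bddmeas_cos; apply: measurable_funD => //.
  apply: measurable_funM => //; exact: measurable_quantile.
rewrite (integral_quantile normal01 (g := fun x => cos (a 0%N * x + c))); last first.
  by apply: bddmeas_cos; exact: measurable_affine.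
rewrite integral_normal01_cos -mulrA -expRD; congr (_ * expR _).
by rewrite big_ord_recl/=; field.
Qed.

End gaussian_sequence.

Section second_moment.
Context d (T : measurableType d) (R : realType) (P : probability T R).

Lemma cvg_one_minus_cos (x : R) :
  2 * n.+1%:R ^+ 2 * (1 - cos (x / n.+1%:R)) @[n --> \oo] --> x ^+ 2.
Proof.
have -> : (fun n => 2 * n.+1%:R ^+ 2 * (1 - cos (x / n.+1%:R))) =
    (fun n => 4 * (n.+1%:R * sin (x / 2 / n.+1%:R)) ^+ 2) :> (nat -> R).
  apply/funext => n; set t := x / 2 / n.+1%:R.
  have -> : x / n.+1%:R = t + t by rewrite /t; field; rewrite gt_eqF.
  by rewrite cosD -!expr2 cos2sin2; ring.
have -> : x ^+ 2 = 4 * (x / 2) ^+ 2 by field.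
apply: cvgM; first exact: cvg_cst.
by rewrite expr2; under eq_fun do rewrite expr2; apply: cvgM; exact: cvg_sin_scale.
Qed.

(** Fatou's lemma for 2 n^2 (1 - cos (X / n)), which tends to X^2 and whose
    integral is 2 n^2 (1 - exp (- 1 / (2 n^2))) <= 1. *)
Lemma second_moment_le1 (X : T -> R) : measurable_fun setT X ->
  (forall t, \int[P]_u cos (t * X u) = expR (- (2^-1 * t ^+ 2))) ->
  (\int[P]_u (X u ^+ 2)%:E <= 1)%E.
Proof.
move=> mX cfX.
pose f n u : R := 2 * n.+1%:R ^+ 2 * (1 - cos (X u / n.+1%:R)).
have bcos (t : R) : bddmeas (fun u => cos (t * X u)).
  by apply: bddmeas_cos; exact: measurable_funM.
have bf n : bddmeas (f n).
  apply: bddmeasM; first exact: bddmeas_cst.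
  have -> : (fun u => 1 - cos (X u / n.+1%:R)) =
      (fun u => 1 + (-1) * cos (n.+1%:R^-1 * X u)).
    by apply/funext => u; rewrite mulN1r [_^-1 * _]mulrC.
  apply: bddmeasD; first exact: bddmeas_cst.
  by apply: bddmeasM; [exact: bddmeas_cst|exact: bcos].
have f0 n u : 0 <= f n u by rewrite mulr_ge0// subr_ge0 cos_le1.
have fX u : (f n u)%:E @[n --> \oo] --> (X u ^+ 2)%:E.
  by apply: cvg_EFin; [exact: nearW|exact: cvg_one_minus_cos].
have If n : (\int[P]_u (f n u)%:E <= 1)%E.
  rewrite -[leLHS]fineK; last exact: integrable_fin_num (bddmeas_integrable P (bf n)).
  rewrite lee_fin -/(Rintegral P setT (f n)).
  pose s : R := n.+1%:R ^+ 2; have s0 : 0 < s by apply: exprn_gt0.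
  have -> : f n = fun u => (- (2 * s)) * cos (n.+1%:R^-1 * X u) + 2 * s.
    by apply/funext => u; rewrite /f -/s [_^-1 * _]mulrC; ring.
  rewrite (bc_linear (Rintegral_bc_functional P)) ?cfX//; last exact: bddmeas_cst.
  rewrite Rintegral_probability_cst exprVn -/s.
  have := expR_ge1Dx (- (2^-1 / s)).
  have : 2 * s * (2^-1 / s) = 1 by field; rewrite gt_eqF.
  by set e := 2^-1 / s; set q := expR _; nra.
have mf n : measurable_fun setT (fun u => (f n u)%:E).
  by apply/measurable_EFinP; case: (bf n).
have := fatou P measurableT mf (fun n u _ => f0 n u : (0 <= (f n u)%:E)%E).
have -> : (fun u => limn_einf (fun n => (f n u)%:E)) = (fun u => (X u ^+ 2)%:E).
  by apply/funext => u; rewrite (cvg_limn_einf_sup (fX u)).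
move=> /le_trans; apply.
rewrite limn_einf_lim; apply: lime_le; first exact: is_cvg_einfs.
apply: nearW => n; apply: le_trans (If n).
by apply: ereal_inf_lbound; exists n => /=.
Qed.

End second_moment.

(** * Fourier series on the circle *)
Section circle_determination.
Context (R : realType).
Local Notation T := (measurableTypeR R).
Local Notation P := (@circle_prob R).
Local Notation I01 := (`[0%R, 1%R[%classic : set R).

(** Frequencies are written as differences of natural numbers to make the
    phases stable under subtraction. *)
Definition circle_phases : set (T -> R) :=
  [set phi | exists m n c, phi = fun t => 2 * pi * (m%:R - n%:R) * t + c].

Let S := trig_sets circle_phases.
Let sigS (A : set T) := measurable (A : set (g_sigma_algebraType S)).

Let PhiB phi psi : circle_phases phi -> circle_phases psi ->
  circle_phases (fun x => phi x - psi x).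
Proof.
move=> [m [n [c ->]]] [m' [n' [c' ->]]]; exists (m + n')%N, (n + m')%N, (c - c').
by apply/funext => x; rewrite !natrD; ring.
Qed.

Let Phic c : circle_phases (fun=> c).
Proof. by exists 0%N, 0%N, c; apply/funext => x; rewrite subrr mulr0 mul0r add0r. Qed.

Let mPhi phi : circle_phases phi -> measurable_fun setT phi.
Proof. by move=> [m [n [c ->]]]; exact: measurable_affine. Qed.

Let arc (c s : R) : sigS [set t | s <= cos (2 * pi * t + c)].
Proof.
apply: sub_sigma_algebra; exists (fun t => 2 * pi * t + c), s; split=> //.
by exists 1%N, 0%N, c; apply/funext => x; rewrite subr0 mulr1.
Qed.

(** The half-line from x is cut out of the unit interval by a condition on the
    sign of sin (2 pi t), which tells the half containing t, and a bound on
    cos (2 pi t), which is monotone on each half. *)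
Let trig_trace (A : set T) : measurable A ->
  exists2 A', sigS A' & A `&` I01 = A' `&` I01.
Proof.
pose C : set (set T) := [set A | exists2 A', sigS A' & A `&` I01 = A' `&` I01].
suff : (@measurable _ T) `<=` C by exact.
have -> : @measurable _ T = <<s @RGenCInfty.G R >> by exact: RGenCInfty.measurableE.
apply: smallest_sub.
  split.
  - by exists set0 => //; exact: measurable0.
  - move=> B [B' sB' E]; exists (~` B'); first exact: measurableC.
    rewrite setTD; apply/seteqP; split=> x [nB Ix]; split=> // Bx; apply: nB.
      by have : (B' `&` I01) x by []; rewrite -E => -[].
    by have : (B `&` I01) x by []; rewrite E => -[].
  - move=> F CF; pose F' n := projT1 (cid2 (CF n)).
    have F'P n : sigS (F' n) /\ F n `&` I01 = F' n `&` I01.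
      by rewrite /F'; case: cid2.
    exists (\bigcup_n F' n); first by apply: bigcupT_measurable => n; case: (F'P n).
    rewrite !setI_bigcupl; apply: eq_bigcup => // n _; exact: (F'P n).2.
move=> _ [x ->].
have [x0|x0] := leP x 0.
  exists setT; first exact: measurableT.
  apply/seteqP; split=> t [_ It]; split=> //=.
  by move: It; rewrite /= !in_itv/= andbT => /andP[t0 _]; exact: le_trans t0.
have [x1|x1] := leP 1 x.
  exists set0; first exact: measurable0.
  apply/seteqP; split=> t /= [] //.
  by rewrite !in_itv/= andbT => xt /andP[_ t1]; lra.
have pi0 := pi_gt0 R.
have cos_half (u v : R) : 0 <= u <= 2^-1 -> 0 <= v <= 2^-1 ->
    (cos (2 * pi * u) <= cos (2 * pi * v)) = (v <= u).
  move=> /andP[u0 u1] /andP[v0 v1]; rewrite leNgt ltr_cos -?leNgt.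
  - by rewrite ler_pM2l// mulr_gt0.
  - by rewrite in_itv/=; apply/andP; split; nra.
  - by rewrite in_itv/=; apply/andP; split; nra.
have twopi : 2 * pi = pi *+ 2 :> R by rewrite mulr_natl.
have cos_refl (u : R) : cos (2 * pi * (1 - u)) = cos (2 * pi * u).
  by rewrite mulrBr mulr1 twopi cosB cos2pi sin2pi mul1r mul0r addr0.
have sin_refl (u : R) : sin (2 * pi * (1 - u)) = - sin (2 * pi * u).
  by rewrite mulrBr mulr1 twopi sinB cos2pi sin2pi mul1r mul0r sub0r.
have sin_low (u : R) : 0 <= u <= 2^-1 -> 0 <= sin (2 * pi * u).
  by move=> /andP[u0 u1]; apply: sin_ge0_pi; apply/andP; split; nra.
have sin_high (u : R) : 2^-1 < u < 1 -> sin (2 * pi * u) < 0.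
  move=> /andP[u0 u1]; rewrite -oppr_gt0 -sin_refl.
  by apply: sin_gt0_pi; apply/andP; split; nra.
have sN0 : sigS [set t | 0 <= sin (2 * pi * t)].
  have := arc (- (pi / 2)) 0; congr (sigS _).
  by apply/funext => t /=; rewrite cosBpihalf.
have sc s : sigS [set t | s <= cos (2 * pi * t)].
  by have := arc 0 s; congr (sigS _); apply/funext => t /=; rewrite addr0.
have sc' u : sigS [set t | cos (2 * pi * t) <= u].
  have := arc (- (pi / 2) - pi / 2) (- u); congr (sigS _).
  by apply/funext => t /=; rewrite addrA cosBpihalf sinBpihalf lerN2.
have [x2|x2] := leP x 2^-1.
  exists (~` [set t | 0 <= sin (2 * pi * t)] `|`
          [set t | cos (2 * pi * t) <= cos (2 * pi * x)]).
    by apply: measurableU; [exact: measurableC|exact: sc'].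
  apply/seteqP; split=> t /= []; rewrite !in_itv/= ?andbT => H /andP[t0 t1]; split=> //;
    try by rewrite t0.
  - have [t2|t2] := leP t 2^-1.
      by right; rewrite cos_half//; apply/andP; split; lra.
    by left; apply/negP; rewrite -ltNge; apply: sin_high; rewrite t2.
  - have [t2|t2] := leP t 2^-1; last by lra.
    case: H => [[]|]; first by apply: sin_low; rewrite t0.
    by rewrite cos_half//; apply/andP; split; lra.
exists (~` [set t | 0 <= sin (2 * pi * t)] `&`
        [set t | cos (2 * pi * x) <= cos (2 * pi * t)]).
  by apply: measurableI; [exact: measurableC|exact: sc].
apply/seteqP; split=> t /= []; rewrite !in_itv/= ?andbT => H /andP[t0 t1]; split=> //;
  try by rewrite t0.
- split; first by apply/negP; rewrite -ltNge; apply: sin_high; apply/andP; split; lra.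
  rewrite -(cos_refl x) -(cos_refl t) cos_half; first lra.
  + by apply/andP; split; lra.
  + by apply/andP; split; lra.
- case: H => sN; have [t2|t2] := leP t 2^-1.
    by exfalso; apply: sN; apply: sin_low; rewrite t0.
  rewrite -(cos_refl x) -(cos_refl t) cos_half; first lra.
  + by apply/andP; split; lra.
  + by apply/andP; split; lra.
Qed.

(** By [trig_determination], h has integral 0 on every trigonometric set, hence
    on every Borel set. *)
Theorem circle_completeness (h : T -> R) : P.-integrable setT (EFin \o h) ->
  (forall m c, \int[P]_t (cos (2 * pi * m%:R * t + c) * h t) = 0) ->
  {ae P, forall t, h t = 0}.
Proof.
move=> inth hcos.
have bcL := integral_bc_functional inth.
have Lphi phi : circle_phases phi -> \int[P]_t (cos (phi t) * h t) = 0.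
  move=> [m [n [c ->]]]; have [mn|/ltnW nm] := leqP n m.
    by rewrite -natrB//; exact: hcos.
  have E (t : R) : cos (2 * pi * (m%:R - n%:R) * t + c) = cos (2 * pi * (n - m)%:R * t + - c).
    by rewrite -cosN natrB//; congr cos; ring.
  by under eq_Rintegral do rewrite E; exact: hcos.
have L0 A' : sigS A' -> measurable (A' : set T) /\ \int[P]_t (\1_A' t * h t) = 0.
  exact: (trig_determination bcL mPhi PhiB Phic Lphi).
have intA (A : set T) : measurable A ->
    P.-integrable setT (EFin \o (fun t => \1_A t * h t)).
  by move=> mA; exact: (bddmeas_integrableM (bddmeas_indic R mA) inth).
have LA (A : set T) : measurable A -> \int[P]_t (\1_A t * h t) = 0.
  move=> mA; have [A' /L0[mA' E0] AA'] := trig_trace mA.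
  apply: etrans E0; rewrite !integral_circle_prob; [|exact: intA|exact: intA].
  apply: eq_Rintegral => t It; congr (_ * _); rewrite !indicE; congr (_%:R).
  have : (t \in A `&` I01) = (t \in A' `&` I01) by rewrite AA'.
  by rewrite !in_setI It !andbT => ->.
have H : ae_eq P setT (EFin \o h) (cst 0%E).
  apply: integral_ae_eq => // E _ mE; rewrite integral_cst// mul0e.
  rewrite integral_mkcond.
  have -> : ((EFin \o h) \_ E) = EFin \o (fun t => \1_E t * h t).
    apply/funext => t; rewrite patchE/= indicE.
    by case: (_ \in _); rewrite ?mul1r ?mul0r.
  rewrite -[LHS]fineK ?(integrable_fin_num _ (intA _ _))//.
  by have := LA E mE; rewrite /Rintegral => ->.
by apply: filterS H => t /(_ I)/= [].
Qed.

End circle_determination.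

Section fourier_basis.
Context (R : realType).
Local Notation T := (measurableTypeR R).
Local Notation P := (@circle_prob R).

(** The real orthonormal system in one sequence: even indices are cosines and
    odd indices are opposites of sines, written as cosines shifted by pi / 2.
    The index 0 is the constant sqrt 2, which is not normalized, and the index 1
    is the null function; both only meet functions of mean 0. *)
Definition basis k (t : T) : R :=
  Num.sqrt 2 * cos (2 * pi * (k./2)%:R * t + (odd k)%:R * (pi / 2)).

Lemma bddmeas_basis k : bddmeas (basis k).
Proof.
apply: bddmeasM; first exact: bddmeas_cst.
by apply: bddmeas_cos; exact: measurable_affine.
Qed.

Lemma basis_le k t : `|basis k t| <= 2.
Proof.
rewrite /basis normrM; have s2 : `|Num.sqrt 2 : R| <= 2.
  by rewrite ger0_norm// -(ler_pXn2r (ltn0Sn 1)) ?nnegrE// sqr_sqrtr//; lra.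
by rewrite -[leRHS]mulr1 ler_pM// cos_max.
Qed.

Lemma integral_circle_cos_nat (m : nat) (c : R) :
  \int[P]_t cos (2 * pi * m%:R * t + c) = (m == 0%N)%:R * cos c.
Proof.
have [->|m0] := eqVneq m 0%N.
  rewrite mul1r; under eq_Rintegral do rewrite mulr0 mul0r add0r.
  exact: Rintegral_probability_cst.
have pi0 := pi_gt0 R.
rewrite integral_circle_cos; last by rewrite !mulf_eq0 !negb_or !pnatr_eq0 m0 (gt_eqF pi0).
rewrite mul0r; have -> : 2 * pi * m%:R + c = c + pi *+ 2 *+ m.
  by rewrite addrC -(mulr_natr (pi *+ 2)) -(mulr_natl pi).
by rewrite (periodicn (@sinD2pi R)) subrr mul0r.
Qed.

Lemma integral_basis_mul j k : (2 <= j)%N ->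
  \int[P]_t (basis j t * basis k t) = (j == k)%:R.
Proof.
move=> j2; rewrite /basis.
set m := j./2; set n := k./2; set r : R := _ * (pi / 2); set s : R := (odd k)%:R * _.
have m0 : (0 < m)%N by rewrite half_gt0.
have bc (p : nat) c : bddmeas (fun t : T => cos (2 * pi * p%:R * t + c)).
  by apply: bddmeas_cos; exact: measurable_affine.
have sumE (p : nat) c : \int[P]_t (cos (2 * pi * p%:R * t + c) +
    cos (2 * pi * (m + n)%:R * t + (r + s))) = (p == 0%N)%:R * cos c.
  rewrite RintegralD//; [|exact: (bddmeas_integrable P (bc p c))|
    exact: (bddmeas_integrable P (bc (m + n)%N (r + s)))].
  by rewrite !integral_circle_cos_nat addn_eq0 (gtn_eqF m0)/= mul0r addr0.
have two : Num.sqrt 2 * Num.sqrt 2 = 2 :> R by rewrite -expr2 sqr_sqrtr.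
have jk : (j == k) = (m == n) && (odd j == odd k).
  apply/idP/andP => [/eqP jk|[/eqP mn /eqP ojk]]; first by rewrite /m /n jk !eqxx.
  by apply/eqP; rewrite -(odd_double_half j) -(odd_double_half k) ojk -/m -/n mn.
have [nm|mn] := leqP n m.
  transitivity (\int[P]_t (cos (2 * pi * (m - n)%:R * t + (r - s)) +
      cos (2 * pi * (m + n)%:R * t + (r + s)))).
    apply: eq_Rintegral => t _; set x := 2 * pi * m%:R * t; set y := 2 * pi * n%:R * t.
    have -> : 2 * pi * (m - n)%:R * t + (r - s) = (x + r) - (y + s).
      by rewrite natrB// /x /y; ring.
    have -> : 2 * pi * (m + n)%:R * t + (r + s) = (x + r) + (y + s).
      by rewrite natrD /x /y; ring.
    rewrite [X in _ = X + _]cosB [X in _ = _ + X]cosD mulrACA two; ring.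
  rewrite sumE subn_eq0 jk eqn_leq nm andbT; case: (m <= n)%N; rewrite ?mul0r// mul1r/=.
  rewrite /r /s; case: (odd j) (odd k) => [] []; rewrite ?mul0r ?mul1r ?subrr ?cos0//.
    by rewrite subr0 cos_pihalf.
  by rewrite sub0r cosN cos_pihalf.
transitivity (\int[P]_t (cos (2 * pi * (n - m)%:R * t + (s - r)) +
    cos (2 * pi * (m + n)%:R * t + (r + s)))).
  apply: eq_Rintegral => t _; set x := 2 * pi * m%:R * t; set y := 2 * pi * n%:R * t.
  have -> : 2 * pi * (n - m)%:R * t + (s - r) = (y + s) - (x + r).
    by rewrite natrB ?(ltnW mn)// /x /y; ring.
  have -> : 2 * pi * (m + n)%:R * t + (r + s) = (x + r) + (y + s).
    by rewrite natrD /x /y; ring.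
  rewrite [X in _ = X + _]cosB [X in _ = _ + X]cosD mulrACA two; ring.
by rewrite sumE jk (ltn_eqF mn) subn_eq0 leqNgt mn mul0r.
Qed.

(** Both trigonometric functions of frequency m are thus tested by [basis]. *)
Lemma cos_basis (m : nat) (c t : R) : cos (2 * pi * m%:R * t + c) =
  (Num.sqrt 2)^-1 * (cos c * basis m.*2 t + sin c * basis m.*2.+1 t).
Proof.
have s0 : Num.sqrt 2 != 0 :> R by rewrite sqrtr_eq0 -ltNge.
rewrite /basis/= doubleK uphalf_double odd_double/= mul0r addr0 mul1r cosDpihalf cosD.
by field.
Qed.

End fourier_basis.

Section parseval.
Context (R : realType).
Local Notation T := (measurableTypeR R).
Local Notation P := (@circle_prob R).

Lemma abs_bounded_cvg (u : nat -> R) (M : R) : (forall n, \sum_(k < n) `|u k| <= M) ->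
  cvgn (fun n => \sum_(k < n) u k).
Proof.
move=> uM.
have -> : (fun n => \sum_(k < n) u k) = series u.
  by apply/funext => n; rewrite /series/= big_mkord.
apply: normed_cvg.
have -> : [normed series u] = (fun n => \sum_(k < n) `|u k|).
  by apply/funext => n; rewrite -(big_mkord xpredT (fun k => `|u k|)).
apply: nondecreasing_is_cvgn; last by exists M => _ [n _ <-].
by apply/nondecreasing_seqP => n; rewrite big_ord_recr/= lerDl.
Qed.

Definition coef (f : T -> R) k : R := \int[P]_t (basis k t * f t).

(** The Fourier series converges uniformly to a bounded function Gl with the
    same coefficients as f; by completeness Gl = f almost everywhere, and the
    integral of Gl f can be computed term by term. *)
Theorem parseval (f : T -> R) (M : R) :
  P.-integrable setT (EFin \o f) -> coef f 0 = 0 -> coef f 1 = 0 ->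
  (forall n, \sum_(k < n) `|coef f k| <= M) ->
  \sum_(k < n) coef f k ^+ 2 @[n --> \oo] --> \int[P]_t (f t ^+ 2).
Proof.
move=> intf c0 c1 cM.
set c := coef f in c0 c1 cM *.
pose G n t := \sum_(k < n) c k * basis k t.
have bG n : bddmeas (G n).
  by case: (bc_functional_sum c (Rintegral_bc_functional P) (@bddmeas_basis R) n).
have M0 : 0 <= M by have := cM 0%N; rewrite big_ord0.
have basisM n t : \sum_(k < n) `|c k * basis k t| <= 2 * M.
  apply: (@le_trans _ _ (\sum_(k < n) 2 * `|c k|)).
    by apply: ler_sum => k _; rewrite normrM mulrC ler_wpM2r// basis_le.
  by rewrite -mulr_sumr ler_wpM2l.
have summ t : cvgn (fun n => G n t).
  exact: (@abs_bounded_cvg (fun k => c k * basis k t) (2 * M) (fun n => basisM n t)).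
pose Gl t := limn (fun n => G n t).
have GM n t : `|G n t| <= 2 * M.
  exact: (le_trans (ler_norm_sum _ _ _) (basisM n t)).
have Gcv t : G n t @[n --> \oo] --> Gl t by exact: summ.
have mG n : measurable_fun setT (G n) by case: (bG n).
have bGl : bddmeas Gl.
  split; first exact: measurable_fun_cvg mG _.
  exists (2 * M) => t; apply: (cvgr_to_le (cvg_norm (@Gcv t))).
  by apply: nearW => n; exact: GM.
have bcP := Rintegral_bc_functional P.
have Lcv (h : T -> R) : P.-integrable setT (EFin \o h) ->
    \sum_(k < n) c k * \int[P]_t (basis k t * h t) @[n --> \oo] -->
    \int[P]_t (Gl t * h t).
  move=> inth; have bcL := integral_bc_functional inth.
  have -> : (fun n => \sum_(k < n) c k * \int[P]_t (basis k t * h t)) =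
      (fun n => \int[P]_t (G n t * h t)).
    by apply/funext => n; case: (bc_functional_sum c bcL (@bddmeas_basis R) n).
  exact: (bc_cvg bcL mG GM Gcv).
have coefG j : \int[P]_t (Gl t * basis j t) = c j.
  apply: (cvg_unique _ (Lcv _ (bddmeas_integrable P (@bddmeas_basis R j)))) => //.
  apply: (@cvg_near_cst); near=> n.
  have jn : (j < n)%N by near: n; exact: nbhs_infty_gt.
  rewrite (bigD1 (Ordinal jn))//= big1 ?addr0 => [|k kj].
    have [j2|j2] := leqP 2 j; first by rewrite integral_basis_mul// eqxx mulr1.
    by rewrite (_ : c j = 0) ?mul0r//; case: (j) j2 => [|[|]].
  have [k2|k2] := leqP 2 k.
    rewrite integral_basis_mul// (_ : (k == j :> nat) = false) ?mulr0//.
    by apply/negbTE; apply: contra kj => /eqP kj; apply/eqP/val_inj.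
  by rewrite (_ : c k = 0) ?mul0r//; case: (nat_of_ord k) k2 => [|[|]].
have intfG : P.-integrable setT (EFin \o (fun t => f t - Gl t)).
  exact: eq_integrable (integrableB measurableT intf (bddmeas_integrable P bGl)).
have aefG : {ae P, forall t, f t - Gl t = 0}.
  apply: circle_completeness => // m a.
  have bcL := integral_bc_functional intfG.
  pose L (g : T -> R) := \int[P]_t (g t * (f t - Gl t)).
  have L0 k : L (basis k) = 0.
    have -> : L (basis k) = c k - \int[P]_t (Gl t * basis k t).
      rewrite /c /coef -RintegralB//.
      - by apply: eq_Rintegral => t _; ring.
      - exact: (bddmeas_integrableM (@bddmeas_basis R k) intf).
      - exact: (bddmeas_integrable P (bddmeasM bGl (@bddmeas_basis R k))).
    by rewrite coefG subrr.
  have bcst := bddmeas_cst T ((Num.sqrt 2)^-1 : R).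
  transitivity (L (fun t => (Num.sqrt 2)^-1 * cos a * basis m.*2 t +
     ((Num.sqrt 2)^-1 * sin a * basis m.*2.+1 t + 0))).
    by congr L; apply/funext => t; rewrite cos_basis; ring.
  have b0 := bddmeas_cst T (0 : R).
  have bb k : bddmeas (basis k) by exact: bddmeas_basis.
  have b1 (r : R) k : bddmeas (fun t => r * basis k t + 0).
    by apply: bddmeasD => //; apply: bddmeasM => //; exact: bddmeas_cst.
  rewrite /L (bc_linear bcL)// (bc_linear bcL)//.
  by rewrite -!/(L _) !L0 !mulr0 bc_functional0// !addr0.
have -> : \int[P]_t (f t ^+ 2) = \int[P]_t (Gl t * f t).
  have mf : measurable_fun setT f.
    by apply/measurable_EFinP; exact: (measurable_int P intf).
  rewrite /Rintegral; congr fine; apply: ae_eq_integral => //.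
  - by apply/measurable_EFinP; exact: measurable_funX.
  - by apply/measurable_EFinP; apply: measurable_funM => //; case: bGl.
  - apply: filterS aefG => t /eqP; rewrite subr_eq0 => /eqP E _ /=.
    by rewrite expr2 {1}E.
have := Lcv f intf.
have -> : (fun n => \sum_(k < n) c k * \int[P]_t (basis k t * f t)) =
    (fun n => \sum_(k < n) c k ^+ 2).
  by apply/funext => n; apply: eq_bigr => k _; rewrite expr2.
exact.
Unshelve. all: end_near.
Qed.

End parseval.

(** * Coefficients of Sobolev functions *)
Section sobolev_coefficients.
Context (R : realType).
Local Open Scope complex_scope.

Definition complex_part (b : bool) (z : R[i]) : R :=
  if b then complex.Im z else complex.Re z.

Lemma coef_fourier (f : L2S R) k :
  coef (L2S_fun f) k = Num.sqrt 2 * complex_part (odd k) (fourier f (k./2 : nat)).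
Proof.
rewrite fourierE /complex_part /coef.
have bsin : bddmeas (fun t : measurableTypeR R => - sin (2 * pi * k./2%:R * t)).
  have -> : (fun t => - sin (2 * pi * k./2%:R * t)) =
      (fun t => cos (2 * pi * k./2%:R * t + pi / 2)) :> (R -> R).
    by apply/funext => t; rewrite cosDpihalf.
  by apply: bddmeas_cos; exact: measurable_affine.
have bcos : bddmeas (fun t : measurableTypeR R => cos (2 * pi * k./2%:R * t)).
  have := bddmeas_cos (@measurable_affine R (2 * pi * k./2%:R) 0).
  by congr bddmeas; apply/funext => t; rewrite addr0.
have intf : (@circle_prob R).-integrable setT (EFin \o L2S_fun f) by exact: integrable_L2S.
case: ifP => ok /=.
  rewrite -RintegralZl//.
    by apply: eq_Rintegral => t _; rewrite /basis ok mul1r cosDpihalf; ring.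
  apply: eq_integrable (bddmeas_integrableM bsin intf) => // t _ /=.
  by rewrite mulrC.
rewrite -RintegralZl//.
  by apply: eq_Rintegral => t _; rewrite /basis ok mul0r addr0; ring.
apply: eq_integrable (bddmeas_integrableM bcos intf) => // t _ /=.
by rewrite mulrC.
Qed.

Lemma coefD (a : R) (f g : L2S R) k :
  coef (L2S_fun (a *: f + g)) k = a * coef (L2S_fun f) k + coef (L2S_fun g) k.
Proof.
rewrite !coef_fourier fourierD /complex_part.
by case: (fourier f _) (fourier g _) => [x y] [x' y']; case: ifP => _ /=; ring.
Qed.

Lemma coef_lt2 (xi : H10 R) k : (k < 2)%N -> coef (L2S_fun xi) k = 0.
Proof.
have /andP[_ /asboolP f0] := H10_valP xi.
case: k => [|[|]]// _; rewrite coef_fourier.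
  by rewrite (_ : fourier _ _ = 0)// /complex_part/= mulr0.
by rewrite (_ : fourier _ _ = 0)// /complex_part/= mulr0.
Qed.

(** Comparable to the squared frequency of [basis k], with an explicitly summable
    inverse. *)
Definition weight k : R := (k.+1 * k.+2)%:R.

Lemma weight_gt0 k : 0 < weight k. Proof. by rewrite ltr0n. Qed.

Lemma sum_weightV n : \sum_(k < n) (weight k)^-1 = 1 - n.+1%:R^-1.
Proof.
elim: n => [|n IH]; first by rewrite big_ord0 invr1 subrr.
rewrite big_ord_recr/= IH /weight natrM.
have n1 : n.+1%:R != 0 :> R by rewrite pnatr_eq0.
have n2 : n.+2%:R != 0 :> R by rewrite pnatr_eq0.
have E : n.+2%:R = n.+1%:R + 1 :> R by rewrite natr1.
rewrite E in n2 *; move: n1 n2; move: (n.+1%:R : R) => x x0 x1.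
by field; rewrite x0 x1.
Qed.

Lemma H10_norm_sqr (xi : H10 R) : H10_norm xi ^+ 2 = fine (sobolev1 xi).
Proof.
rewrite /H10_norm sqr_sqrtr// fine_ge0// esum_ge0// => n _.
by rewrite lee_fin mulr_ge0 ?sqr_ge0.
Qed.

Lemma sobolev_sum_le (xi : H10 R) n :
  \sum_(m < n) m%:R ^+ 2 * ComplexField.Normc.normc (fourier xi m) ^+ 2 <= H10_norm xi ^+ 2.
Proof.
have /andP[/asboolP fin _] := H10_valP xi.
rewrite H10_norm_sqr -lee_fin fineK; last first.
  rewrite ge0_fin_numE// esum_ge0// => m _.
  by rewrite lee_fin mulr_ge0 ?sqr_ge0.
apply: esum_ge; exists (Posz @` `I_n).
  by split=> //; apply: finite_image; exact: finite_II.
rewrite fsbig_image; last by move=> i j _ _ [].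
by rewrite -fsbig_ord sumEFin.
Qed.

(** The indices 2m and 2m+1 share the frequency m >= 1; their weights are at most
    20 m^2 and their squared coefficients add up to twice the squared modulus of
    the complex coefficient of frequency m. *)
Lemma weighted_coef_le (xi : H10 R) n :
  \sum_(k < n) weight k * coef (L2S_fun xi) k ^+ 2 <= 40 * H10_norm xi ^+ 2.
Proof.
set c := coef _.
have c0 k : 0 <= weight k * c k ^+ 2 by rewrite mulr_ge0 ?sqr_ge0 ?ltW ?weight_gt0.
apply: (@le_trans _ _ (\sum_(k < n.*2) weight k * c k ^+ 2)).
  rewrite -!(big_mkord xpredT (fun k => weight k * c k ^+ 2)).
  have n2 : (n <= n.*2)%N by rewrite -addnn leq_addr.
  rewrite (big_cat_nat (leq0n n) n2)/=.
  by rewrite lerDl sumr_ge0.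
pose q (m : nat) : R := m%:R ^+ 2 * ComplexField.Normc.normc (fourier xi m) ^+ 2.
apply: (@le_trans _ _ (\sum_(m < n) 40 * q m)); last first.
  by rewrite -mulr_sumr ler_wpM2l// sobolev_sum_le.
elim: n => [|n IH]; first by rewrite !big_ord0.
rewrite doubleS !big_ord_recr/= -addrA lerD//.
case: n {IH} => [|n].
  have z0 : c 0%N = 0 by exact: coef_lt2.
  have z1 : c 1%N = 0 by exact: coef_lt2.
  by rewrite /= z0 z1 /q !expr0n/= !mulr0 addr0 mul0r mulr0.
have h1 : n.+1.*2.+1./2 = n.+1 by exact: (uphalf_double n.+1).
have o1 : odd n.+1.*2.+1 by rewrite oddS odd_double.
rewrite /c !coef_fourier h1 o1 doubleK odd_double /q normc_sqr.
set z := fourier _ _.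
rewrite !exprMn sqr_sqrtr// /complex_part.
have w (k : nat) : (k <= n.+1.*2.+1)%N -> weight k <= 20 * n.+1%:R ^+ 2 :> R.
  move=> kn; rewrite /weight -natrX -natrM ler_nat.
  apply: (@leq_trans (n.+1.*2.+2 * n.+1.*2.+3)); first by rewrite leq_mul.
  rewrite -!muln2 expnS expn1; nia.
have := w n.+1.*2 (leqnSn _); have := w n.+1.*2.+1 (leqnn _).
have := sqr_ge0 (complex.Re z); have := sqr_ge0 (complex.Im z).
set a := _ ^+ 2; set b := _ ^+ 2; set N := _ ^+ 2.
by nra.
Qed.

End sobolev_coefficients.

(** * Sample functionals *)
Section dual_element.
Context (R : realType).
Variable y : nat -> R.

Definition weighted_bounded :=
  exists M : R, forall n, \sum_(k < n) y k ^+ 2 / weight R k <= M.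

Let term (xi : H10 R) k := y k * coef (L2S_fun xi) k.

Definition seq_pairing (xi : H10 R) : R := limn (fun n => \sum_(k < n) term xi k).

(** The Cauchy-Schwarz bound in additive form, where the free parameter t
    replaces the square roots. *)
Lemma sum_term_le (xi : H10 R) (M t : R) n :
  (forall n, \sum_(k < n) y k ^+ 2 / weight R k <= M) -> 0 < t ->
  \sum_(k < n) `|term xi k| <= 2^-1 * (M / t + t * (40 * H10_norm xi ^+ 2)).
Proof.
move=> yM t0; have wc := weighted_coef_le xi n; set c := coef _ in wc.
apply: (@le_trans _ _ (2^-1 * (t^-1 * (\sum_(k < n) y k ^+ 2 / weight R k) +
    t * \sum_(k < n) weight R k * c k ^+ 2))); last first.
  rewrite ler_wpM2l// lerD//; first by rewrite mulrC ler_wpM2r ?invr_ge0 ?(ltW t0).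
  by rewrite ler_wpM2l// ltW.
rewrite !mulr_sumr -big_split/= mulr_sumr; apply: ler_sum => k _.
have w0 := weight_gt0 R k; set w := weight R k in w0 *.
(* 2 a b <= a^2 / (t w) + t w b^2 *)
rewrite /term normrM.
have -> : y k ^+ 2 = `|y k| ^+ 2 by rewrite real_normK// num_real.
have -> : c k ^+ 2 = `|c k| ^+ 2 by rewrite real_normK// num_real.
set a := `|y k|; set b := `|_|.
rewrite -subr_ge0.
have -> : 2^-1 * (t^-1 * (a ^+ 2 / w) + t * (w * b ^+ 2)) - a * b =
    2^-1 * (t * w)^-1 * (a - t * w * b) ^+ 2.
  by field; rewrite !gt_eqF.
by rewrite mulr_ge0 ?sqr_ge0// mulr_ge0 ?invr_ge0 ?mulr_ge0 ?ltW.
Qed.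

Hypothesis yb : weighted_bounded.

Lemma cvg_seq_pairing (xi : H10 R) :
  \sum_(k < n) term xi k @[n --> \oo] --> seq_pairing xi.
Proof.
have [M yM] := yb.
exact: (@abs_bounded_cvg R (term xi) _ (fun n => sum_term_le xi n yM ltr01)).
Qed.

Lemma coef_H10D (a : R) (xi eta : H10 R) k :
  coef (L2S_fun (a *: xi + eta : H10 R)) k =
  a * coef (L2S_fun xi) k + coef (L2S_fun eta) k.
Proof. by rewrite -coefD. Qed.

Lemma seq_pairing_scalar : scalar seq_pairing.
Proof.
move=> a xi eta.
apply: (cvg_unique _ (@cvg_seq_pairing (a *: xi + eta))) => //.
have -> : (fun n => \sum_(k < n) term (a *: xi + eta) k) =
    (fun n => a * (\sum_(k < n) term xi k) + \sum_(k < n) term eta k).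
  apply/funext => n; rewrite mulr_sumr -big_split/=; apply: eq_bigr => k _.
  by rewrite /term coef_H10D; ring.
apply: cvgD; last exact: cvg_seq_pairing.
by apply: cvgM; [exact: cvg_cst|exact: cvg_seq_pairing].
Qed.

(** The convergence hypothesis is kept as an argument, so that linearity can be
    attached to this function. *)
Definition dual_fun : H10 R -> R := seq_pairing.

HB.instance Definition _ :=
  GRing.isLinear.Build R (H10 R) R *%R dual_fun seq_pairing_scalar.

Lemma dual_fun_continuous (xi0 : H10 R) (e : R) : 0 < e ->
  exists2 delta : R, 0 < delta & forall xi : H10 R,
    H10_norm (xi - xi0) < delta -> `|dual_fun xi - dual_fun xi0| < e.
Proof.
move=> e0; have [M yM] := yb.
have M0 : 0 <= M by have := yM 0%N; rewrite big_ord0.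
(* t makes the constant part of the bound less than e / 2 *)
pose t := (M + 1) / e.
have t0 : 0 < t by rewrite divr_gt0//; lra.
have bound (xi : H10 R) : `|dual_fun xi| <= 2^-1 * (M / t + t * (40 * H10_norm xi ^+ 2)).
  apply: (cvgr_to_le (cvg_norm (@cvg_seq_pairing xi))).
  by apply: nearW => n; exact: (le_trans (ler_norm_sum _ _ _) (sum_term_le xi n yM t0)).
have d0 : 0 < e / t / 40 by apply: divr_gt0 => //; exact: divr_gt0.
exists (Num.sqrt (e / t / 40)) => [|xi xid]; first by rewrite sqrtr_gt0.
rewrite -raddfB; apply: (le_lt_trans (bound _)).
have N0 : 0 <= H10_norm (xi - xi0) by rewrite sqrtr_ge0.
have : H10_norm (xi - xi0) ^+ 2 < e / t / 40.
  rewrite -[ltRHS]sqr_sqrtr ?(ltW d0)//.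
  by rewrite ltr_pXn2r ?nnegrE ?sqrtr_ge0.
have : M / t < e by rewrite ltr_pdivrMr// /t mulrC divfK ?gt_eqF//; lra.
have : t * (e / t) = e by rewrite mulrC divfK// gt_eqF.
set q := e / t; set N := _ ^+ 2.
by nra.
Qed.

Definition dual_element : Hm1 R := MkHm1 dual_fun_continuous.

End dual_element.

(** * White noise and its uniqueness *)
Section random_dual_element.
Context (R : realType).
Local Notation T := (measurableTypeR R).
Local Notation P := (@circle_prob R).
Local Notation g := (@gaussian_seq R).
Local Notation w := (weight R).

Lemma gaussian_seq_second_moment k : (\int[P]_u (g k u ^+ 2)%:E <= 1)%E.
Proof.
apply: second_moment_le1; first exact: measurable_gaussian_seq.
move=> t; pose a j := if j == k then t else 0.
have E (h : nat -> R) : \sum_(j < k.+1) a j * h j = t * h k.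
  rewrite big_ord_recr/= /a eqxx big1 ?add0r// => j _.
  by rewrite ltn_eqF ?mul0r.
have := gaussian_seq_cf k.+1 a 0; rewrite cos0 mul1r.
have -> : \sum_(j < k.+1) a j ^+ 2 = t ^+ 2.
  transitivity (\sum_(j < k.+1) a j * a j); last by rewrite (E a) /a eqxx expr2.
  by apply: eq_bigr => j _; rewrite expr2.
by move=> <-; apply: eq_Rintegral => u _; rewrite (E (fun k => g k u)) addr0.
Qed.

Let weighted_sum (u : T) : \bar R := \sum_(0 <= k <oo) (g k u ^+ 2 / w k)%:E.

Let term_ge0 k u : (0 <= (g k u ^+ 2 / w k)%:E)%E.
Proof. by rewrite lee_fin mulr_ge0 ?sqr_ge0// invr_ge0 ltW// weight_gt0. Qed.

Let measurable_term k : measurable_fun setT (fun u => (g k u ^+ 2 / w k)%:E).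
Proof.
apply/measurable_EFinP; apply: measurable_funM => //.
by apply: measurable_funX; exact: measurable_gaussian_seq.
Qed.

Let measurable_weighted_sum : measurable_fun setT weighted_sum.
Proof. by apply: ge0_emeasurable_sum => // k u _ _; exact: term_ge0. Qed.

Definition summable_event : set T := [set u | weighted_sum u \is a fin_num].

Lemma measurable_summable_event : measurable summable_event.
Proof.
by have := emeasurable_fin_num measurableT measurable_weighted_sum; rewrite setTI.
Qed.

Lemma summable_event_ae : {ae P, forall u, summable_event u}.
Proof.
have termE k : (\int[P]_u (g k u ^+ 2 / w k)%:E <= ((w k)^-1)%:E)%E.
  under eq_integral do rewrite mulrC EFinM.
  have w0 : 0 <= (w k)^-1 by rewrite invr_ge0 ltW// weight_gt0.
  rewrite ge0_integralZl//.
  - rewrite -[leRHS]mule1; apply: lee_wpmul2l; first by rewrite lee_fin.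
    exact: gaussian_seq_second_moment.
  - by apply/measurable_EFinP/measurable_funX; exact: measurable_gaussian_seq.
  - by move=> u _; rewrite lee_fin sqr_ge0.
have fin : (\int[P]_u weighted_sum u <= 1)%E.
  rewrite /weighted_sum integral_nneseries//.
  apply: lime_le.
    by apply: is_cvg_nneseries => k _ _; apply: integral_ge0 => u _; exact: term_ge0.
  apply: nearW => n; rewrite big_mkord.
  apply: (@le_trans _ _ (\sum_(k < n) ((w k)^-1)%:E)%E).
    by apply: lee_sum => k _; exact: termE.
  by rewrite sumEFin sum_weightV lee_fin lerBlDr lerDl invr_ge0.
have int : P.-integrable setT weighted_sum.
  apply/integrableP; split=> //.
  under eq_integral do rewrite gee0_abs ?nneseries_ge0//.
  exact: le_lt_trans fin (ltry _).
have := integrable_ae measurableT int.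
by apply: filterS => u /(_ I).
Qed.

(** On the exceptional null event all coordinates are set to 0, so that every
    sample defines a functional. *)
Definition coords (u : T) k : R := g k u * \1_summable_event u.

Lemma measurable_coords k : measurable_fun setT (fun u => coords u k).
Proof.
apply: measurable_funM; first exact: measurable_gaussian_seq.
by apply: measurable_indic; exact: measurable_summable_event.
Qed.

Lemma coords_bounded u : weighted_bounded (coords u).
Proof.
have [su|nsu] := pselect (summable_event u); last first.
  exists 0 => n; rewrite big1// => k _.
  by rewrite /coords indicE memNset// mulr0 expr0n mul0r.
exists (fine (weighted_sum u)) => n.
rewrite -lee_fin fineK//.
under eq_bigr do rewrite /coords indicE mem_set// mulr1.
rewrite -sumEFin -(big_mkord xpredT (fun k => (g k u ^+ 2 / w k)%:E)).
by apply: nneseries_lim_ge => k _ _; exact: term_ge0.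
Qed.

Definition random_dual (u : T) : Hm1_borel R := dual_element (@coords_bounded u).

Lemma measurable_seq_pairing xi : measurable_fun setT (fun u => seq_pairing (coords u) xi).
Proof.
apply: (measurable_fun_cvg (h := fun n u => \sum_(k < n) coords u k * coef (L2S_fun xi) k)).
  move=> n; apply: measurable_sum => k; apply: measurable_funM => //.
  exact: measurable_coords.
by move=> u _; exact: (cvg_seq_pairing (@coords_bounded u)).
Qed.

Lemma measurable_random_dual : measurable_fun setT random_dual.
Proof.
apply: (measurability (rT := Hm1_borel R) (@cylinder R : set (set (Hm1_borel R))) erefl).
move=> _ [_ [n [xi [A [mA ->]]]] <-]; rewrite setTI.
pose F u : n.-tuple T := [tuple seq_pairing (coords u) (xi i) | i < n].
suff mF : measurable_fun setT F by have := mF measurableT A mA; rewrite setTI.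
apply/measurable_fun_tnthP => i.
rewrite (_ : _ \o F = fun u => seq_pairing (coords u) (xi i)).
  exact: measurable_seq_pairing.
by apply/funext => u; rewrite /= tnth_mktuple.
Qed.

HB.instance Definition _ :=
  @isMeasurableFun.Build _ _ _ _ random_dual measurable_random_dual.

Definition white_noise : probability (Hm1_borel R) R := distribution P random_dual.

End random_dual_element.

Local Open Scope complex_scope.

Section characteristic_functional.
Context (R : realType).
Local Notation T := (measurableTypeR R).
Local Notation P := (@circle_prob R).

Lemma measurable_pairing (xi : H10 R) :
  measurable_fun setT (fun x : Hm1_borel R => pairing x xi : T).
Proof.
move=> _ B mB; rewrite setTI; apply: sub_sigma_algebra.
exists 1%N, (fun=> xi), ((fun t => tnth t ord0) @^-1` B); split.
  by have := @measurable_tnth _ T 1 ord0 measurableT B mB; rewrite setTI.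
by apply/seteqP; split=> x /=; rewrite tnth_mktuple.
Qed.

(** The phase c encodes both parts of the complex integral: c = 0 gives the real
    part and c = - pi / 2 the imaginary part. *)
Lemma char_functionalE (mu : probability (Hm1_borel R) R) (xi : H10 R) :
  char_functional mu xi = (gaussC xi)%:C <->
  forall c, \int[mu]_x cos (pairing x xi + c) = cos c * gaussC xi.
Proof.
have bcos c : bddmeas (fun x : Hm1_borel R => cos (pairing x xi + c)).
  apply: bddmeas_cos; apply: measurable_funD => //.
  exact: measurable_pairing.
pose I c := \int[mu]_x cos (pairing x xi + c).
have E : char_functional mu xi = I 0 +i* I (- (pi / 2)).
  rewrite /char_functional /Cintegral; congr (_ +i* _); apply: eq_Rintegral => x _ /=.
    by rewrite addr0.
  by rewrite cosBpihalf.
rewrite E; split=> [[I0 I1] c|H].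
  have bI := Rintegral_bc_functional mu.
  have b0 := bddmeas_cst (Hm1_borel R) (0 : R).
  transitivity (cos c * I 0 + (- sin c * I (- (pi / 2)) + 0)); last first.
    by rewrite I0 I1 mulr0 !addr0.
  rewrite /I -[X in _ + X](_ : \int[mu]_x
      (- sin c * cos (pairing x xi - pi / 2) + 0) = _); last first.
    by rewrite (bc_linear bI)// Rintegral_probability_cst.
  rewrite -(bc_linear bI)//; last first.
    by apply: bddmeasD => //; apply: bddmeasM => //; exact: bddmeas_cst.
  apply: eq_Rintegral => x _.
  by rewrite cosBpihalf !addr0 cosD; ring.
by rewrite /I !H cos0 mul1r cosN cos_pihalf mul0r.
Qed.

Lemma L2_norm_sqr (f : L2S R) : L2_norm f ^+ 2 = \int[P]_t (L2S_fun f t ^+ 2).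
Proof.
rewrite /L2_norm sqr_sqrtr; last by apply: Rintegral_ge0 => t _; exact: sqr_ge0.
by apply: eq_Rintegral => t _; rewrite real_normK// num_real.
Qed.

Lemma parseval_H10 (xi : H10 R) :
  \sum_(k < n) coef (L2S_fun xi) k ^+ 2 @[n --> \oo] --> L2_norm xi ^+ 2.
Proof.
rewrite L2_norm_sqr.
have one n : \sum_(k < n) (1 : R) ^+ 2 / weight R k <= 1.
  under eq_bigr do rewrite expr1n mul1r.
  by rewrite sum_weightV lerBlDr lerDl invr_ge0.
apply: (parseval (M := 2^-1 * (1 / 1 + 1 * (40 * H10_norm xi ^+ 2)))).
- exact: integrable_L2S.
- exact: coef_lt2.
- exact: coef_lt2.
- move=> n; have := @sum_term_le R (fun=> 1) xi 1 1 n one ltr01.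
  by under eq_bigr do rewrite mul1r.
Qed.

(** The finite sums have a Gaussian characteristic function; both sides pass to
    the limit, by bounded convergence and by Parseval's identity. *)
Lemma white_noise_cf (xi : H10 R) :
  char_functional (white_noise R) xi = (gaussC xi)%:C.
Proof.
apply/char_functionalE => c.
set f := L2S_fun xi.
have bcos : bddmeas (fun x : Hm1_borel R => cos (pairing x xi + c)).
  apply: bddmeas_cos; apply: measurable_funD => //.
  exact: measurable_pairing.
have -> : \int[white_noise R]_x cos (pairing x xi + c) =
    \int[P]_u cos (seq_pairing (coords u) xi + c).
  rewrite /Rintegral integral_pushforward//.
  - by apply/measurable_EFinP; case: bcos.
  - apply: (@bddmeas_integrable _ _ _ P (fun u => cos (seq_pairing (coords u) xi + c))).
    exact: (bddmeas_comp (@measurable_random_dual R) bcos).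
pose S n u := \sum_(k < n) coords u k * coef f k.
have mS n : measurable_fun setT (S n).
  apply: measurable_sum => k; apply: measurable_funM => //; exact: measurable_coords.
have cv1 : \int[P]_u cos (S n u + c) @[n --> \oo] -->
    \int[P]_u cos (seq_pairing (coords u) xi + c).
  apply: (bc_cvg (Rintegral_bc_functional P) (C := 1)).
  - move=> n; have [] // := @bddmeas_cos _ T R (fun u => S n u + c).
    by apply: measurable_funD.
  - by move=> n u; exact: cos_max.
  - move=> u; apply: (cvg_comp (fun n => S n u + c) (@cos R)); last exact: continuous_cos.
    apply: cvgD; last exact: cvg_cst.
    exact: (cvg_seq_pairing (@coords_bounded R u)).
have E n : \int[P]_u cos (S n u + c) =
    cos c * expR (- (2^-1 * \sum_(k < n) coef f k ^+ 2)).
  rewrite -gaussian_seq_cf /Rintegral; congr fine.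
  apply: ae_eq_integral => //.
  - apply/measurable_EFinP; have [] // := @bddmeas_cos _ T R (fun u => S n u + c).
    by apply: measurable_funD.
  - apply/measurable_EFinP.
    have [] // := @bddmeas_cos _ T R (fun u => \sum_(k < n) coef f k * gaussian_seq k u + c).
    by apply: measurable_funD => //; exact: measurable_gaussian_sum.
  - apply: filterS (@summable_event_ae R) => u su _; congr (cos (_ + c))%:E.
    by apply: eq_bigr => k _; rewrite /coords indicE mem_set// mulr1 mulrC.
apply: (cvg_unique _ cv1) => //.
have -> : (fun n => \int[P]_u cos (S n u + c)) =
    (fun n => cos c * expR (- (2^-1 * \sum_(k < n) coef f k ^+ 2))).
  exact/funext.
apply: cvgM; first exact: cvg_cst.
apply: (cvg_comp _ (@expR R)); last exact: continuous_expR.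
apply: cvgN; apply: cvgM; first exact: cvg_cst.
exact: parseval_H10.
Qed.

(** The phases are the functions x |-> (x, xi) + c: they form a group since the
    pairing is linear in xi, and each is a limit as in [measurable_trig_phase]
    since xi can be divided by n, so they generate all cylinders. *)
Lemma char_functional_unique (mu nu : probability (Hm1_borel R) R) :
  (forall xi, char_functional mu xi = (gaussC xi)%:C) ->
  (forall xi, char_functional nu xi = (gaussC xi)%:C) ->
  forall A : set (Hm1_borel R), measurable A -> nu A = mu A.
Proof.
move=> Hmu Hnu A mA.
pose Phi : set (Hm1_borel R -> R) :=
  [set phi | exists xi c, phi = fun x => pairing x xi + c].
have mPhi phi : Phi phi -> measurable_fun setT phi.
  move=> [xi [c ->]]; apply: measurable_funD => //; exact: measurable_pairing.
have PhiB phi psi : Phi phi -> Phi psi -> Phi (fun x => phi x - psi x).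
  move=> [xi [c ->]] [eta [c' ->]]; exists (xi - eta), (c - c').
  by apply/funext => x; rewrite /pairing raddfB; ring.
have Phic c : Phi (fun=> c).
  by exists 0, c; apply/funext => x; rewrite /pairing raddf0 add0r.
apply: (cos_measure_unique mPhi PhiB Phic).
  move=> _ [xi [c ->]].
  by have /char_functionalE -> := Hmu xi; have /char_functionalE -> := Hnu xi.
move: A mA; apply: smallest_sub; first exact: smallest_sigma_algebra.
move=> _ [n [xi [B [mB ->]]]].
pose F (x : g_sigma_algebraType (trig_sets Phi)) : n.-tuple T :=
  [tuple pairing x (xi i) | i < n].
suff mF : measurable_fun setT F by have := mF measurableT B mB; rewrite setTI.
apply/measurable_fun_tnthP => i.
rewrite (_ : _ \o F = fun x => pairing x (xi i)); last first.
  by apply/funext => x; rewrite /= tnth_mktuple.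
apply: (measurable_trig_phase PhiB Phic) => k.
exists (k.+1%:R^-1 *: xi i), 0; apply/funext => x.
by rewrite /pairing linearZ/= addr0 mulrC.
Qed.

End characteristic_functional.

(* A measure is a function on all sets, only constrained on measurable ones:
   uniqueness is equality on the sigma-algebra. *)
Theorem theorem3 (R : realType) :
  exists mu : probability (Hm1_borel R) R,
    (forall xi : H10 R, char_functional mu xi = (gaussC xi)%:C) /\
    (forall nu : probability (Hm1_borel R) R,
      (forall xi : H10 R, char_functional nu xi = (gaussC xi)%:C) ->
      forall A : set (Hm1_borel R), measurable A -> nu A = mu A).
Proof.
exists (white_noise R); split=> [xi|nu Hnu A mA]; first exact: white_noise_cf.
by apply: char_functional_unique => //; exact: white_noise_cf.
Qed.
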